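(* Let $\ell\in\frac12\mathbb{N}$, $\ell>0$, and $\nu>0$, and let $W^{(\nu)}$ be the matrix-valued Gegenbauer weight defined in the context. Define the matrix-valued differential operators (acting from the right) $$D^{(\nu)}=\Bigl(\frac{d^2}{dx^2}\Bigr)(1-x^2)+\Bigl(\frac{d}{dx}\Bigr)\bigl(C-x(2\ell+2\nu+1)\mathrm{I}\bigr)-V,\qquad E^{(\nu)}=\Bigl(\frac{d}{dx}\Bigr)(xB_1+B_0)+A_0^{(\nu)},$$ where $$C=\sum_{i=0}^{2\ell-1}(2\ell-i)E_{i,i+1}+\sum_{i=1}^{2\ell}iE_{i,i-1},\qquad V=-\sum_{i=0}^{2\ell}i(2\ell-i)E_{i,i},$$ $$2\ell\,B_0=\sum_{i=0}^{2\ell-1}(2\ell-i)E_{i,i+1}-\sum_{i=1}^{2\ell}iE_{i,i-1},\qquad \ell\,B_1=-\sum_{i=0}^{2\ell}(\ell-i)E_{i,i},$$ $$\ell\,A_0^{(\nu)}=\sum_{i=0}^{2\ell}\bigl((\ell+1)(i-2\ell)-(\nu-1)(\ell-i)\bigr)E_{i,i}.$$ Then $D^{(\nu)}$ and $E^{(\nu)}$ are symmetric with respect to the weight $W^{(\nu)}$, and $D^{(\nu)}$ and $E^{(\nu)}$ commute.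
   Context: Matrices are $(2\ell+1)\times(2\ell+1)$, indexed by $\{0,1,\dots,2\ell\}$; $E_{i,j}$ are the matrix units; $(a)_0=1$, $(a)_n=a(a+1)\cdots(a+n-1)$. The Gegenbauer polynomials are $C^{(\nu)}_n(x)=\frac{(2\nu)_n}{n!}\,{}_2F_1\!\left(-n,\,n+2\nu;\,\nu+\tfrac12;\,\tfrac12(1-x)\right)$. Definition of the weight. For $x\in(-1,1)$ and $m,n\in\{0,\dots,2\ell\}$ with $n\ge m$, $$\bigl(W^{(\nu)}(x)\bigr)_{m,n}=(1-x^2)^{\nu-1/2}\sum_{t=\max(0,n+m-2\ell)}^{m}\alpha^{(\nu)}_t(m,n)\,C^{(\nu)}_{m+n-2t}(x),$$ $$\alpha^{(\nu)}_t(m,n)=(-1)^m\frac{n!\,m!\,(m+n-2t)!}{t!\,(2\nu)_{m+n-2t}\,(\nu)_{n+m-t}}\,\frac{(\nu)_{n-t}(\nu)_{m-t}}{(n-t)!\,(m-t)!}\,\frac{n+m-2t+\nu}{n+m-t+\nu}\,(2\ell-m)!\,(n-2\ell)_{m-t}\,(-2\ell-\nu)_t\,\frac{2\ell+\nu}{(2\ell)!},$$ and $W^{(\nu)}(x)$ is extended to a symmetric matrix. Inner product: $\langle P,Q\rangle^{(\nu)}=\int_{-1}^1P(x)W^{(\nu)}(x)Q(x)^\ast\,dx\in M_{2\ell+1}(\mathbb{C})$. A matrix-valued differential operator $D=\frac{d^2}{dx^2}F_2+\frac{d}{dx}F_1+F_0$ with matrix-valued functions $F_i$ acts from the right: $(PD)(x)=\frac{d^2P}{dx^2}(x)F_2(x)+\frac{dP}{dx}(x)F_1(x)+P(x)F_0(x)$,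 with entrywise derivatives. It is symmetric with respect to $W^{(\nu)}$ if $\langle PD,Q\rangle^{(\nu)}=\langle P,QD\rangle^{(\nu)}$ for all matrix-valued functions $P,Q$ with $C^2([-1,1])$-entries. Two operators $D,E$ commute if $(PD)E=(PE)D$ for all sufficiently smooth matrix-valued functions $P$. *)

(* Defs.v *)
From HB Require Import structures.
From mathcomp Require Import all_boot all_order all_algebra.
From mathcomp Require Import complex.
From mathcomp Require Import all_classical all_reals all_analysis.

Set Implicit Arguments.
Unset Strict Implicit.
Unset Printing Implicit Defensive.

Import Order.TTheory GRing.Theory Num.Theory.
Import numFieldNormedType.Exports.

Local Open Scope classical_set_scope.
Local Open Scope ring_scope.
Local Open Scope complex_scope.
Local Open Scope sesquilinear_scope.

(* Throughout, N stands for 2 * l, so that "l in (1/2)N, l > 0" reads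
   "N : nat, 0 < N"; matrices have size N.+1. *)

Section calculus.
Variable R : realType.
Implicit Types (A : set R) (f : R -> R).

Definition diffquot f (x y : R) : R := (f y - f x) / (y - x).

(* Derivative of the restriction of f to A: one-sided at an endpoint of an
   interval A, and depending on the values of f on A only. *)
Definition derivable_on A f (x : R) : Prop :=
  cvg (diffquot f x y @[y --> within A x^']).

Definition derive_on A f (x : R) : R :=
  lim (diffquot f x y @[y --> within A x^']).

Fixpoint Ck_on (k : nat) A f : Prop :=
  {within A, continuous f} /\
  match k with
  | 0 => True
  | k'.+1 => (forall x, A x -> derivable_on A f x) /\
             Ck_on k' A (derive_on A f)
  end.

Definition mx_Ck_on n (k : nat) A (P : R -> 'M[R[i]]_n) : Prop :=
  forall i j, Ck_on k A (fun x => complex.Re (P x i j)) /\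
              Ck_on k A (fun x => complex.Im (P x i j)).

Definition mx_derive_on n A (P : R -> 'M[R[i]]_n) (x : R) : 'M[R[i]]_n :=
  \matrix_(i, j) (derive_on A (fun y => complex.Re (P y i j)) x
                  +i* derive_on A (fun y => complex.Im (P y i j)) x).

Definition mx_Rintegral n A (P : R -> 'M[R[i]]_n) : 'M[R[i]]_n :=
  \matrix_(i, j)
    ((\int[@lebesgue_measure R]_(x in A) complex.Re (P x i j))
     +i* (\int[@lebesgue_measure R]_(x in A) complex.Im (P x i j))).

End calculus.

Section diffop.
Variables (R : realType) (n : nat).
Implicit Types (P Q : R -> 'M[R[i]]_n).

(* (d^2/dx^2) F2(x) + (d/dx) F1(x) + F0(x) *)
Record diffop := Diffop {
  dcoef2 : R -> 'M[R[i]]_n;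
  dcoef1 : R -> 'M[R[i]]_n;
  dcoef0 : R -> 'M[R[i]]_n }.

(* The right action P |-> PD on functions with domain A. *)
Definition diffop_act (A : set R) P (D : diffop) (x : R) : 'M[R[i]]_n :=
  mx_derive_on A (mx_derive_on A P) x *m dcoef2 D x
  + mx_derive_on A P x *m dcoef1 D x + P x *m dcoef0 D x.

Definition mx_inner (W P Q : R -> 'M[R[i]]_n) : 'M[R[i]]_n :=
  mx_Rintegral `]-1, 1[ (fun x => P x *m W x *m (Q x) ^t*).

Definition diffop_symmetric (W : R -> 'M[R[i]]_n) (D : diffop) : Prop :=
  forall P Q, mx_Ck_on 2 `[-1, 1] P -> mx_Ck_on 2 `[-1, 1] Q ->
  mx_inner W (diffop_act `[-1, 1] P D) Q =
  mx_inner W P (diffop_act `[-1, 1] Q D).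

(* (PD)E = (PE)D for all P of class C^k on any nondegenerate interval. *)
Definition diffop_commute (k : nat) (D E : diffop) : Prop :=
  forall I : set R, is_interval I -> interior I !=set0 ->
  forall P, mx_Ck_on k I P ->
  forall x, I x ->
  diffop_act I (diffop_act I P D) E x = diffop_act I (diffop_act I P E) D x.

End diffop.

Section weight.
Variable R : realType.
Implicit Types (a b c x z nu : R) (N k m n t : nat).

Definition poch a n : R := \prod_(i < n) (a + i%:R).

Definition hyp2F1 a b c z : R :=
  limn (series (fun k => poch a k * poch b k / (poch c k * k`!%:R) * z ^+ k)).

Definition gegenbauer nu n x : R :=
  poch (2 * nu) n / n`!%:R *
  hyp2F1 (- n%:R) (n%:R + 2 * nu) (nu + 2^-1) (2^-1 * (1 - x)).

(* Used for t <= m <= n <= N only, so the nat subtractions are exact. *)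
Definition walpha N nu t m n : R :=
  (-1) ^+ m
  * ((n`! * m`! * (m + n - 2 * t)`!)%:R
     / (t`!%:R * poch (2 * nu) (m + n - 2 * t) * poch nu (n + m - t)))
  * (poch nu (n - t) * poch nu (m - t) / ((n - t)`! * (m - t)`!)%:R)
  * (((n + m - 2 * t)%:R + nu) / ((n + m - t)%:R + nu))
  * (N - m)`!%:R * poch (n%:R - N%:R) (m - t) * poch (- N%:R - nu) t
  * ((N%:R + nu) / N`!%:R).

(* In the summation range, n + m - N is truncated: max(0, n + m - N). *)
Definition weight_upper N nu x m n : R :=
  (1 - x ^+ 2) `^ (nu - 2^-1) *
  \sum_(n + m - N <= t < m.+1)
     walpha N nu t m n * gegenbauer nu (m + n - 2 * t) x.

Definition weight N nu x : 'M[R[i]]_N.+1 :=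
  \matrix_(m, n) (if (m <= n)%N then weight_upper N nu x m n
                  else weight_upper N nu x n m)%:C.

End weight.

Section operators.
Variables (R : realType) (N : nat).
Implicit Types (x nu : R).

Local Notation E i j := (delta_mx (inord i) (inord j) : 'M[R[i]]_N.+1).

Definition ell : R[i] := N%:R / 2.

Definition matC : 'M[R[i]]_N.+1 :=
  \sum_(0 <= i < N) (N - i)%:R *: E i i.+1
  + \sum_(1 <= i < N.+1) i%:R *: E i i.-1.

Definition matV : 'M[R[i]]_N.+1 :=
  - \sum_(0 <= i < N.+1) (i * (N - i))%:R *: E i i.

Definition matB0 : 'M[R[i]]_N.+1 :=
  (2 * ell)^-1 *: (\sum_(0 <= i < N) (N - i)%:R *: E i i.+1
                   - \sum_(1 <= i < N.+1) i%:R *: E i i.-1).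

Definition matB1 : 'M[R[i]]_N.+1 :=
  ell^-1 *: - \sum_(0 <= i < N.+1) (ell - i%:R) *: E i i.

Definition matA0 nu : 'M[R[i]]_N.+1 :=
  ell^-1 *: \sum_(0 <= i < N.+1)
    ((ell + 1) * (i%:R - 2 * ell) - (nu%:C - 1) * (ell - i%:R)) *: E i i.

Definition opD nu : diffop R N.+1 := Diffop
  (fun x => (1 - x ^+ 2)%:C%:M)
  (fun x => matC - (x%:C * (2 * ell + 2 * nu%:C + 1))%:M)
  (fun _ => - matV).

Definition opE nu : diffop R N.+1 := Diffop
  (fun _ => 0)
  (fun x => x%:C *: matB1 + matB0)
  (fun _ => matA0 nu).

End operators.

(* Main.v *)
(* Put p_k = 2F1(-k, k + 2 nu; nu + 1/2; (1 - x)/2), w = (1 - x^2)^(nu - 1/2),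
   N = 2 l, and write the weight as w a_{m,n} with a_{m,n} polynomial. Rewriting
   alpha_t symmetrically in the four integers i = m - t, j = n - t, t and
   s = N - m - n + t gives, up to a constant,
     a_{m,n} = m! n! (N - m)! (N - n)! sum_t g(i, j, s, t) (i + j + nu) p_{i+j}.
   The recurrences of p_k for multiplication by x and for (1 - x^2) d/dx turn
   relations between neighbouring entries into identities between at most six
   values of g. With h_{m,n} = m! n! (N - m)! (N - n)! sum_t g (p_{k-1} - p_{k+1})/2
   these are
     (1 - x^2) a' = m a_{m-1,n} + n a_{m,n-1} - (m + n) x a,
     (2m - N) x a + (N - m) a_{m+1,n} - m a_{m-1,n} = (n - m)(N + 2 nu) h,
     (N - n) a_{m,n+1} + n a_{m,n-1} - (N - m) a_{m+1,n} - m a_{m-1,n}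
       = 2 (m - n)(N - m - n) h,
   and the Gegenbauer equation gives (w h)' = - w a for m <> n. Since h is
   symmetric and w h vanishes at both endpoints, these relations are exactly the
   pointwise symmetry equations of E and D, and symmetry follows by Green's
   formula. Commutation is an identity in the representation of sl_2 spanned by
   the superdiagonal part of C, its subdiagonal part and diag(N - 2 i). *)

Require Import Defs.
From mathcomp Require Import all_boot all_order all_algebra.
From mathcomp Require Import complex.
From mathcomp Require Import all_classical all_reals all_analysis.
From mathcomp Require Import measurable_realfun.
From mathcomp Require Import ring lra zify.

Set Implicit Arguments.
Unset Strict Implicit.
Unset Printing Implicit Defensive.

Import Order.TTheory GRing.Theory Num.Theory.
Import numFieldNormedType.Exports.

Local Open Scope ring_scope.

(** * Coefficients *)

(** Two obstacles shape the proof. Neighbouring entries have different summation ranges for t, so a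
    direct comparison would split into boundary cases. The coefficient g is therefore defined for
    all integers, with factors that vanish at negative arguments; all sums then share one range, and
    each relation becomes a rational identity in i, j, s, t. Only equality of the coefficients of
    the p_k is used, never their linear independence. The other obstacle is analytic: for nu < 1/2
    the weight is unbounded at the endpoints. The boundary terms are therefore written as (1 -
    x^2)^(nu + 1/2) times polynomials. For F2 W this is possible because F2 is 1 - x^2 or 0, and for
    the antisymmetric half of F1 W because h is divisible by 1 - x^2 off the diagonal. On the
    diagonal the summand with k = 0 contributes p_{-1} - p_1 = -x, which does not vanish at the
    endpoints, but there h has coefficient 0. Both operators have real coefficients, so the analysis
    is done for real matrices, and complex functions enter through their real and imaginary
    parts. *)

Section reciprocal_poch.
Variables (R : realType).
Implicit Types (a nu : R) (z : int).

Lemma poch0 a : poch a 0 = 1. Proof. exact: big_ord0. Qed.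
Lemma pochS a n : poch a n.+1 = poch a n * (a + n%:R).
Proof. exact: big_ord_recr. Qed.
Lemma pochSl a n : poch a n.+1 = a * poch (a + 1) n.
Proof.
rewrite /poch big_ord_recl /= addr0; congr (_ * _); apply: eq_bigr => i _.
by rewrite /bump /= natrD addrA.
Qed.
Lemma poch_gt0 a n : 0 < a -> 0 < poch a n.
Proof. by move=> a0; apply: prodr_gt0 => i _; rewrite ltr_wpDr. Qed.
Lemma poch_neq0 a n : 0 < a -> poch a n != 0.
Proof. by move=> a0; rewrite gt_eqF// poch_gt0. Qed.

Lemma poch1 n : poch 1 n = n`!%:R :> R.
Proof.
elim: n => [|n IH]; first by rewrite poch0 fact0.
by rewrite pochS IH factS natrM mulrC nat1r.
Qed.

(* Gamma(a) / Gamma(a + z), so that [inv_pochE] has no exceptional index. *)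
Definition inv_poch a z : R :=
  match z with
  | Posz n => (poch a n)^-1
  | Negz n => \prod_(i < n.+1) (a - i.+1%:R)
  end.

Lemma inv_pochE a z : 0 < a -> inv_poch a z = (a + z%:~R) * inv_poch a (z + 1).
Proof.
move=> a0; case: z => n.
  have -> : n%:Z + 1 = n.+1%:Z by lia.
  rewrite /= pochS invfM mulrCA mulfV ?mulr1 //.
  by rewrite gt_eqF// ltr_wpDr// ler0z.
case: n => [|n].
  have -> : Negz 0 + 1 = 0%:Z by lia.
  by rewrite /= big_ord_recl big_ord0 poch0 NegzE mulrNz invr1.
have -> : Negz n.+1 + 1 = Negz n by rewrite !NegzE; lia.
by rewrite /= big_ord_recr /= mulrC NegzE mulrNz.
Qed.

Definition inv_fact z : R := inv_poch 1 z.

Lemma inv_fact_nat (n : nat) : inv_fact n%:Z = n`!%:R^-1.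
Proof. by rewrite /inv_fact /= poch1. Qed.
Lemma inv_fact_lt0 z : z < 0 -> inv_fact z = 0.
Proof. by case: z => // n _; rewrite /inv_fact /= big_ord_recl subrr mul0r. Qed.
Lemma inv_factE z : inv_fact z = (z + 1)%:~R * inv_fact (z + 1).
Proof. by rewrite /inv_fact inv_pochE// intrD addrC. Qed.

(* (a)_z / z!, which is 0 for z < 0; the three cases of [poch_factP] are the way the
   boundary of the summation range enters the identities below. *)
Definition poch_fact a z : R :=
  match z with
  | Posz n => poch a n / n`!%:R
  | Negz _ => 0
  end.

Lemma poch_fact_lt0 a z : z < 0 -> poch_fact a z = 0. Proof. by case: z. Qed.

Variant poch_fact_spec a z : R -> R -> Type :=
 | PochFactNeg : z + 1 < 0 -> poch_fact_spec a z 0 0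
 | PochFactM1 : z = -1 -> poch_fact_spec a z 0 1
 | PochFactPos : 0 <= z -> (z%:~R + 1 : R) != 0 ->
    poch_fact_spec a z (poch_fact a z) ((a + z%:~R) / (z%:~R + 1) * poch_fact a z).

Lemma poch_factP a z : poch_fact_spec a z (poch_fact a z) (poch_fact a (z + 1)).
Proof.
case: z => n.
  have n1 : (n%:R + 1 : R) != 0 by rewrite natr1 pnatr_eq0.
  have -> : poch_fact a (n%:Z + 1) = ((a + n%:Z%:~R) / (n%:Z%:~R + 1)
    * poch_fact a n%:Z).
    have -> : n%:Z + 1 = n.+1%:Z by lia.
    rewrite /= pochS factS natrM invfM -nat1r addrC.
    rewrite -!pmulrn. field.
    by rewrite n1 pnatr_eq0 -lt0n fact_gt0.
  exact: (@PochFactPos a n%:Z isT n1).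
case: n => [|n].
  have -> : Negz 0 + 1 = 0%:Z by lia.
  by rewrite /= poch0 fact0 divr1; exact: PochFactM1.
have -> : Negz n.+1 + 1 = Negz n by rewrite !NegzE; lia.
by apply: PochFactNeg; rewrite !NegzE; lia.
Qed.

Section coef.
Variable nu : R.
Hypothesis nu0 : 0 < nu.
Implicit Types i j s t : int.

(* The coefficient alpha_t(m, n) in the variables i = m - t, j = n - t and
   s = N - m - n + t, without the factors depending on m, n and N only. *)
Definition gcoef i j s t : R :=
  poch_fact nu i * poch_fact nu j * inv_fact s * inv_fact t
  * inv_poch nu (i + j + t + 1) * inv_poch nu (i + j + s + 1).

Lemma gcoefC i j s t : gcoef i j s t = gcoef j i s t.
Proof. by rewrite /gcoef (addrC i j) (mulrC (poch_fact nu i)). Qed.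

Section shift.
Variables i j s t : int.
(** Common factor of all values of [gcoef] in one relation: each argument of a reciprocal is raised
    to the largest value that occurs, so that only polynomials and [poch_fact] at [i], [i + 1], [j],
    [j + 1] remain. *)
Let c : R := inv_fact s * inv_fact t * inv_poch nu (i + j + t + 2)
  * inv_poch nu (i + j + s + 2).
Let K : R := i%:~R + j%:~R + 1 + nu.

Lemma gcoef_shift00 :
  gcoef i j s t = c * (K + t%:~R) * (K + s%:~R) * poch_fact nu i * poch_fact nu j.
Proof.
rewrite /gcoef /c (inv_pochE (i + j + t + 1)) // (inv_pochE (i + j + s + 1)) //.
by rewrite -!addrA !intrD /K; ring.
Qed.

Lemma gcoef_shift10 :
  gcoef (i + 1) j (s - 1) t = c * s%:~R * (K + s%:~R) * poch_fact nu (i + 1)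
    * poch_fact nu j.
Proof.
rewrite /gcoef /c (inv_factE (s - 1)) subrK.
rewrite (_ : i + 1 + j + t + 1 = i + j + t + 2); last by lia.
rewrite (_ : i + 1 + j + (s - 1) + 1 = i + j + s + 1); last by lia.
rewrite (inv_pochE (i + j + s + 1)) // (_ : _ + 1 + 1 = i + j + s + 2); last by lia.
by rewrite /K; ring.
Qed.

Lemma gcoef_shift01 :
  gcoef (i + 1) j s (t - 1) = c * t%:~R * (K + t%:~R) * poch_fact nu (i + 1)
    * poch_fact nu j.
Proof.
rewrite /gcoef /c (inv_factE (t - 1)) subrK.
rewrite (_ : i + 1 + j + s + 1 = i + j + s + 2); last by lia.
rewrite (_ : i + 1 + j + (t - 1) + 1 = i + j + t + 1); last by lia.
rewrite (inv_pochE (i + j + t + 1)) // (_ : _ + 1 + 1 = i + j + t + 2); last by lia.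
by rewrite /K; ring.
Qed.

Lemma gcoef_shift11 :
  gcoef (i + 1) (j + 1) (s - 1) (t - 1) =
  c * s%:~R * t%:~R * poch_fact nu (i + 1) * poch_fact nu (j + 1).
Proof.
rewrite /gcoef /c (inv_factE (t - 1)) (inv_factE (s - 1)) !subrK.
rewrite (_ : i + 1 + _ + _ + 1 = i + j + t + 2); last by lia.
rewrite (_ : i + 1 + _ + (s - 1) + 1 = i + j + s + 2); last by lia.
by ring.
Qed.
End shift.

Section identities.
Variables i j s t : int.
Local Notation k := (i%:~R + j%:~R : R).
Local Notation m := (i%:~R + t%:~R : R).
Local Notation n := (j%:~R + t%:~R : R).
Local Notation N := (i%:~R + j%:~R + s%:~R + t%:~R : R).

(* In each relation the index u of p_{m+n+1-2u} is fixed: terms multiplied by x and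
   neighbours (m+1, n), (m, n+1) contribute with t = u, the others with t = u - 1. *)
Let g10 := gcoef (i + 1) j (s - 1) t.
Let g01 := gcoef i (j + 1) (s - 1) t.
Let g10' := gcoef (i + 1) j s (t - 1).
Let g01' := gcoef i (j + 1) s (t - 1).
Let g11 := gcoef (i + 1) (j + 1) (s - 1) (t - 1).

Let g01E : g01 = gcoef (j + 1) i (s - 1) t. Proof. by rewrite /g01 gcoefC. Qed.
Let g01E' : g01' = gcoef (j + 1) i s (t - 1). Proof. by rewrite /g01' gcoefC. Qed.

(** Coefficient of p_{k+1}, k = i + j, in the relation for (1 - x^2) a'. The contributions of the
    derivative and of (m + n) x a are already merged, which produces the factors t (k + 2 nu) and (k
    + 2) (k + 1 + t + nu). *)
Lemma gcoef_relB :
  (k + 2) * (k + 1 + t%:~R + nu) * g11 + t%:~R * (k + 2 * nu) * gcoef i j s t =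
  (k + 1 + nu) * ((N - m + 1) * g01' + (N - n + 1) * g10').
Proof.
rewrite g01E' /g10' /g11 gcoef_shift11 (gcoef_shift01 i) (gcoef_shift01 j)
  (gcoef_shift00 i) (addrC j i).
by case: (poch_factP nu i) => [_|->|_ i1]; case: (poch_factP nu j) => [_|->|_ j1];
  field; rewrite ?i1 ?j1.
Qed.

Lemma gcoef_relH :
  (2 * m - N) * (k + 2 * nu) / 2 * gcoef i j s t + (m + 1) * (k + 1 + nu) * g10
  + (2 * m - N) * (k + 2) / 2 * g11 - (N - m + 1) * (k + 1 + nu) * g01' =
  (n - m) * (N + 2 * nu) / 2 * (g11 - gcoef i j s t).
Proof.
rewrite g01E' /g10 /g11 gcoef_shift11 gcoef_shift10 (gcoef_shift01 j) (gcoef_shift00 i)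
  (addrC j i).
by case: (poch_factP nu i) => [_|->|_ i1]; case: (poch_factP nu j) => [_|->|_ j1];
  field; rewrite ?i1 ?j1.
Qed.

Lemma gcoef_relS :
  (k + 1 + nu) * ((n + 1) * g01 - (m + 1) * g10 + (N - n + 1) * g10'
                  - (N - m + 1) * g01') =
  (m - n) * (N - m - n) * (g11 - gcoef i j s t).
Proof.
rewrite g01E g01E' /g10 /g10' /g11 gcoef_shift11 (gcoef_shift10 i) (gcoef_shift10 j).
rewrite (gcoef_shift01 i) (gcoef_shift01 j) (gcoef_shift00 i) (addrC j i).
by case: (poch_factP nu i) => [_|->|_ i1]; case: (poch_factP nu j) => [_|->|_ j1];
  field; rewrite ?i1 ?j1.
Qed.
End identities.
End coef.
End reciprocal_poch.

(** * Normalized Gegenbauer polynomials *)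

Section hypergeometric.
Variables (R : realType) (nu : R).
Hypothesis nu0 : 0 < nu.

Definition hyp_coef (k j : nat) : R :=
  poch (- k%:R) j * poch (k%:R + 2 * nu) j / (poch (nu + 2^-1) j * j`!%:R).

Lemma poch_neg k j : (k < j)%N -> poch (- k%:R : R) j = 0.
Proof.
move=> kj; rewrite /poch (bigD1 (Ordinal kj)) //= addrC subrr mul0r //.
Qed.

Lemma hyp_coef_gt k j : (k < j)%N -> hyp_coef k j = 0.
Proof. by move=> kj; rewrite /hyp_coef poch_neg // !mul0r. Qed.

Let half_neq0 j : nu + 2^-1 + j%:R != 0.
Proof. by rewrite gt_eqF// ltr_wpDr// addr_gt0// invr_gt0. Qed.
Let pochh_neq0 j : poch (nu + 2^-1) j != 0.
Proof. by rewrite poch_neq0// addr_gt0// invr_gt0. Qed.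
Let fact_neq0 j : (j`!%:R : R) != 0.
Proof. by rewrite pnatr_eq0 -lt0n fact_gt0. Qed.
Let S_neq0 j : (1 + j%:R : R) != 0.
Proof. by rewrite nat1r pnatr_eq0. Qed.

Let twice_neq0 j : nu * 2 + 1 + j%:R * 2 != 0.
Proof. by rewrite gt_eqF//; have := ler0n R j; move: nu0; lra. Qed.

Lemma hyp_coefS k j :
  (j%:R + 1) * (j%:R + nu + 2^-1) * hyp_coef k j.+1 =
  (j%:R - k%:R) * (j%:R + k%:R + 2 * nu) * hyp_coef k j.
Proof.
rewrite /hyp_coef !pochS factS natrM -nat1r.
move: (pochh_neq0 j); set h := poch (_ + _^-1) _ => h0; field.
by rewrite h0 fact_neq0 S_neq0 twice_neq0.
Qed.

Lemma poch_pred (a : R) j : poch (a - 1) j.+1 = (a - 1) * poch a j.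
Proof. by rewrite pochSl subrK. Qed.
Lemma poch_succ (a : R) j :
  a != 0 -> poch (a + 1) j.+1 = poch a j * (a + j%:R) * (a + j%:R + 1) / a.
Proof.
move=> a0; apply: (mulfI a0); rewrite -pochSl !pochS -[in LHS]natr1; field.
exact: a0.
Qed.

Let kap_neq0 k : (- k.+1%:R : R) != 0.
Proof. by rewrite oppr_eq0 pnatr_eq0. Qed.
Let lam_neq0 k : k.+1%:R + 2 * nu != 0.
Proof. by rewrite gt_eqF// addr_gt0// ?ltr0n// mulr_gt0. Qed.

(** Changing k by one shifts the two numerator parameters by one in opposite directions. Hence all
    neighbouring coefficients are rational multiples of one [X], and the recurrences below become
    identities for [field]. *)
Let hyp_coef_mid k j : let ka := - k.+1%:R in let la := k.+1%:R + 2 * nu in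
  let X := poch ka j * poch la j / (poch (nu + 2^-1) j * j`!%:R) in
  let d := (nu + 2^-1 + j%:R) * (j%:R + 1) in
  [/\ hyp_coef k.+1 j = X, hyp_coef k.+1 j.+1 = X * (ka + j%:R) * (la + j%:R) / d,
    hyp_coef k j.+1 =
      X * (ka + j%:R) * (ka + j%:R + 1) / ka * (la - 1) / d
  & hyp_coef k.+2 j.+1 = X * (ka - 1) * (la + j%:R) * (la + j%:R + 1) / la / d].
Proof.
move=> ka la X d.
have fE : j.+1`!%:R = (j%:R + 1) * j`!%:R :> R by rewrite factS natrM natr1.
have e1 : - k%:R = ka + 1 by rewrite /ka -natr1; ring.
have e2 : - k.+2%:R = ka - 1 by rewrite /ka -natr1; ring.
have e3 : k%:R + 2 * nu = la - 1 by rewrite /la -natr1; ring.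
have e4 : k.+2%:R + 2 * nu = la + 1 by rewrite /la -[k.+2%:R]natr1; ring.
rewrite /hyp_coef e1 e2 e3 e4 !poch_pred (poch_succ _ (kap_neq0 k)).
rewrite (poch_succ _ (lam_neq0 k)) -/ka -/la !pochS fE /X /d !invfM.
by split; ring.
Qed.

Lemma hyp_coef_rec k j :
  2 * (k.+1%:R + nu) * (hyp_coef k.+1 j.+1 - 2 * hyp_coef k.+1 j) =
  (k.+1%:R + 2 * nu) * hyp_coef k.+2 j.+1 + k.+1%:R * hyp_coef k j.+1.
Proof.
case: (hyp_coef_mid k j) => -> -> -> ->.
have := lam_neq0 k; have := kap_neq0 k; rewrite oppr_eq0.
set X := _ / (_ * _`!%:R).
set K := k.+1%:R => K0 L0; field.
by rewrite natr1 !nat1r !pnatr_eq0 twice_neq0 -/K L0.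
Qed.

Lemma hyp_coef_deriv k j :
  4 * (k.+1%:R + nu) * (j%:R * hyp_coef k.+1 j - (j.+1%:R) * hyp_coef k.+1 j.+1) =
  k.+1%:R * (k.+1%:R + 2 * nu) * (hyp_coef k j.+1 - hyp_coef k.+2 j.+1).
Proof.
case: (hyp_coef_mid k j) => -> -> -> ->; rewrite -natr1.
have := lam_neq0 k; have := kap_neq0 k; rewrite oppr_eq0.
set X := _ / (_ * _`!%:R).
set K := k.+1%:R => K0 L0; field.
by rewrite natr1 !nat1r !pnatr_eq0 twice_neq0 -/K L0.
Qed.

Lemma hyp_coef0 k : hyp_coef k 0 = 1.
Proof. by rewrite /hyp_coef !poch0 fact0 !mul1r invr1. Qed.

Definition hyp_poly k : {poly R} := \poly_(j < k.+1) hyp_coef k j.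

Lemma coef_hyp_poly k j : (hyp_poly k)`_j = hyp_coef k j.
Proof. by rewrite coef_poly; case: ltnP => // /hyp_coef_gt ->. Qed.

Lemma hyp_poly0 : hyp_poly 0 = 1.
Proof.
apply/polyP => -[|j]; rewrite coef_hyp_poly coef1 ?hyp_coef0 //.
by rewrite hyp_coef_gt.
Qed.

Lemma hyp_poly_rec k :
  (2 * (k.+1%:R + nu))%:P * (1 - 2 *: 'X) * hyp_poly k.+1 =
  (k.+1%:R + 2 * nu)%:P * hyp_poly k.+2 + k.+1%:R%:P * hyp_poly k.
Proof.
apply/polyP => j; rewrite -mulrA mulrBl mul1r -scalerAl !coefD !coefCM coefB coefZ
  coefXM.
rewrite !coef_hyp_poly; case: j => [|j] /=; last by rewrite -hyp_coef_rec mulrA.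
by rewrite !hyp_coef0; ring.
Qed.

Lemma hyp_poly_rec0 : (2 * nu)%:P * (1 - 2 *: 'X) * hyp_poly 0 = (2 * nu)%:P * hyp_poly
  1.
Proof.
apply/polyP => j; rewrite hyp_poly0 mulr1 !coefCM coefB coefZ coefX coef1 coef_hyp_poly.
case: j => [|[|j]] /=; rewrite ?hyp_coef0; [ring| |by rewrite hyp_coef_gt//; ring].
have E : hyp_coef 1 1 = -2.
  have := hyp_coefS 1 0; rewrite hyp_coef0 => E; apply: (mulfI (half_neq0 0)).
  by rewrite -[LHS]mul1r; lra.
by rewrite E; ring.
Qed.

(** In the variable z = (1 - x) / 2 the operator (1 - x^2) d/dx is - 2 z (1 - z) d/dz. *)
Lemma hyp_poly_deriv k :
  (4 * (k.+1%:R + nu))%:P * ('X * (1 - 'X)) * (hyp_poly k.+1)^`() =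
  (k.+1%:R * (k.+1%:R + 2 * nu))%:P * (hyp_poly k.+2 - hyp_poly k).
Proof.
apply/polyP => j; rewrite -!mulrA mulrBl mul1r mulrBr !coefCM !coefB !coefXM.
rewrite !coef_deriv !coef_hyp_poly; case: j => [|j] /=.
  by rewrite !hyp_coef0; ring.
have -> : (if j == 0%N then 0 else hyp_coef k.+1 j.-1.+1 *+ j.-1.+1) =
    j%:R * hyp_coef k.+1 j by case: j => [|j] /=; rewrite ?mul0r // mulr_natl.
rewrite -(mulr_natl _ j.+1).
by have := hyp_coef_deriv k j; lra.
Qed.

(** Hypergeometric equation with a + b + 1 = 2 c, whence the first-order coefficient c (1 - 2 z).
    Comparing coefficients gives the two-term recurrence [hyp_coefS]. *)
Lemma hyp_poly_ode k :
  'X * (1 - 'X) * (hyp_poly k)^`(2) + (nu + 2^-1)%:P * (1 - 2 *: 'X) * (hyp_poly k)^`()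
  + (k%:R * (k%:R + 2 * nu))%:P * hyp_poly k = 0.
Proof.
apply/polyP => j; rewrite coef0 -!mulrA mulrBl mul1r !mulrBr mulrBl mul1r.
rewrite -scalerAl !coefD !coefCM !coefB coefZ !coefXM !coef_deriv !coef_hyp_poly.
rewrite coefN !coefXM !coef_deriv !coef_hyp_poly.
have E0 := hyp_coefS k 0; have E1 := hyp_coefS k 1.
case: j => [|[|j]] /=; [by lra|by lra|].
by have := hyp_coefS k j.+2; lra.
Qed.

Let y : {poly R} := 2^-1 *: (1 - 'X).
Definition gegen k : {poly R} := hyp_poly k \Po y.

Let comp1 : 1 \Po y = 1. Proof. by rewrite -polyC1 comp_polyC. Qed.
Let compE := (comp1, comp_polyB, comp_polyD, comp_polyM, comp_polyC, comp_polyZ,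
  comp_polyX).

Let twoy : 1 - 2 *: y = 'X.
Proof. have e : 2 * 2^-1 = 1 :> R by rewrite mulfV// pnatr_eq0.
by rewrite /y scalerA e scale1r; ring. Qed.
Let half2 : (2^-1 : R)%:P * 2 = 1.
Proof.
have <- : (2%:R)%:P = 2 :> {poly R} by exact: polyC_natr.
by rewrite -polyCM mulVf ?pnatr_eq0.
Qed.
Let yy : 4%:P * (y * (1 - y)) = 1 - 'X ^+ 2.
Proof.
rewrite /y -!mul_polyC polyC_natr.
have -> : 4 = 2 * 2 :> {poly R} by ring.
set c := _%:P; have c2 : c * 2 = 1 := half2.
transitivity ((c * 2) * (1 - 'X) * (2 - (c * 2) * (1 - 'X))); first by ring.
by rewrite c2; ring.
Qed.

Lemma gegen0 : gegen 0 = 1.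
Proof. by rewrite /gegen hyp_poly0 comp_polyC. Qed.

Lemma gegen_rec k :
  (2 * (k.+1%:R + nu))%:P * 'X * gegen k.+1 =
  (k.+1%:R + 2 * nu)%:P * gegen k.+2 + k.+1%:R%:P * gegen k.
Proof.
by have := congr1 (comp_poly y) (hyp_poly_rec k); rewrite !compE twoy.
Qed.

Lemma gegen_rec0 : (2 * nu)%:P * 'X * gegen 0 = (2 * nu)%:P * gegen 1.
Proof.
by have := congr1 (comp_poly y) hyp_poly_rec0; rewrite !compE twoy.
Qed.

Let gegen_der k : (hyp_poly k)^`() \Po y = - 2%:P * (gegen k)^`().
Proof.
rewrite /gegen deriv_comp /y derivZ derivB derivX derivC sub0r -mul_polyC polyC_natr.
set c := _%:P; set Z := _ \Po _.
transitivity (c * 2 * Z); first by rewrite half2 mul1r.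
by ring.
Qed.

Let gegen_der2 k : (hyp_poly k)^`(2) \Po y = 4%:P * (gegen k)^`(2).
Proof.
have := congr1 (fun p => p^`()) (gegen_der k).
rewrite deriv_comp /y derivZ derivB derivX derivC sub0r -mul_polyC.
rewrite derivM derivN derivC oppr0 mul0r add0r !polyC_natr !derivSn !derivn0.
set c := _%:P; set Z := _ \Po _ => E.
transitivity (c * 2 * Z); first by rewrite half2 mul1r.
transitivity (- (Z * (c * -1) * 2)); first by ring.
by rewrite E; ring.
Qed.

Lemma gegen_deriv k :
  (2 * (k.+1%:R + nu))%:P * (1 - 'X ^+ 2) * (gegen k.+1)^`() =
  (k.+1%:R * (k.+1%:R + 2 * nu))%:P * (gegen k - gegen k.+2).
Proof.
have := congr1 (comp_poly y) (hyp_poly_deriv k).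
rewrite !compE gegen_der -yy !rmorphM /= !polyC_natr -/(gegen k) -/(gegen k.+2) => E.
by apply: oppr_inj; rewrite -[RHS]mulrN opprB -E; ring.
Qed.

Lemma gegen_ode k :
  (1 - 'X ^+ 2) * (gegen k)^`(2) - (2 * nu + 1)%:P * 'X * (gegen k)^`()
  + (k%:R * (k%:R + 2 * nu))%:P * gegen k = 0.
Proof.
have := congr1 (comp_poly y) (hyp_poly_ode k).
rewrite !compE gegen_der gegen_der2 -yy twoy -/(gegen k).
have -> : (2 * nu + 1)%:P = 2 * (nu + 2^-1)%:P.
  have <- : (2%:R)%:P = 2 :> {poly R} by exact: polyC_natr.
  by rewrite -polyCM; congr polyC; field.
by rewrite !polyC_natr polyC0 => <-; ring.
Qed.
End hypergeometric.

(** * Relations between neighbouring entries of the weight *)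

Section gegenbauer_expansion.
Variables (R : realType) (nu : R).
Hypothesis nu0 : 0 < nu.
Implicit Types (k m n t : int).

(* The value 0 for k < 0 is harmless: the coefficients vanish there. *)
Definition gegenz k : {poly R} :=
  match k with Posz n => gegen nu n | Negz _ => 0 end.

Local Notation p := gegenz.
Local Notation O := (1 - 'X ^+ 2 : {poly R}).

Lemma gegenz_rec k : 0 <= k ->
  (2 * (k%:~R + nu))%:P * 'X * p k =
  (k%:~R + 2 * nu)%:P * p (k + 1) + k%:~R%:P * p (k - 1).
Proof.
case: k => // -[_|k _].
  by rewrite /= !add0r mul0r addr0 gegen_rec0.
have -> : k.+1%:Z + 1 = k.+2%:Z by lia.
have -> : k.+1%:Z - 1 = k%:Z by lia.
exact: gegen_rec.
Qed.

Lemma gegenz_deriv k : 0 <= k ->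
  (2 * (k%:~R + nu))%:P * O * (p k)^`() =
  (k%:~R * (k%:~R + 2 * nu))%:P * (p (k - 1) - p (k + 1)).
Proof.
case: k => // -[_|k _].
  by rewrite /= gegen0 -polyC1 derivC !mul0r mulr0.
have -> : k.+1%:Z + 1 = k.+2%:Z by lia.
have -> : k.+1%:Z - 1 = k%:Z by lia.
exact: gegen_deriv.
Qed.

Section positive_index.
Variable k : int.
Hypothesis k0 : 0 < k.
Let q := p (k - 1) - p (k + 1).
Let B : {poly R} := (k%:~R * (k%:~R + 2 * nu))%:P.
Let A : {poly R} := (2 * (k%:~R + nu))%:P.
Let kR0 : (0 : R) < k%:~R. Proof. by rewrite ltr0z. Qed.
Let B0 : k%:~R * (k%:~R + 2 * nu) != 0.
Proof. by rewrite gt_eqF// mulr_gt0// addr_gt0// mulr_gt0. Qed.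

(** For k > 0 the factor [B] is nonzero, so [q] is a multiple of (1 - x^2) p_k'. For k = 0 it would
    be -x. *)
Lemma gegenz_diff_root x : x ^+ 2 = 1 -> q.[x] = 0.
Proof.
move=> x1; have := congr1 (horner^~ x) (gegenz_deriv (ltW k0)).
rewrite -/q -/A -/B !hornerM hornerD hornerN hornerXn -[X in X.[x] - _]polyC1.
by rewrite !hornerC x1 subrr mulr0 mul0r => /esym/eqP; rewrite mulf_eq0 (negbTE B0) =>
  /eqP.
Qed.

(** Multiplied by w / (1 - x^2), this reads (w q)' = - A w p_k. Since B q = A (1 - x^2) p_k', it is
    the Gegenbauer equation in self-adjoint form. *)
Lemma gegenz_diff_ode :
  O * q^`() - (2 * nu - 1)%:P * 'X * q = - (A * O * p k).
Proof.
have B0' : B != 0 by rewrite polyC_eq0.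
have E := gegenz_deriv (ltW k0); rewrite -/q -/A -/B in E.
have ode : O * (p k)^`(2) - (2 * nu + 1)%:P * 'X * (p k)^`() + B * p k = 0.
  by rewrite /B; case: (k) k0 => // n _; exact: gegen_ode.
have E' : A * (- (2%:P * 'X) * (p k)^`() + O * (p k)^`(2)) = B * q^`().
  have := congr1 (fun u => u^`()) E.
  rewrite !derivM !derivC !mul0r !add0r derivB derivXn -polyC1 derivC sub0r => <-.
  rewrite polyC_natr. ring.
apply: (mulfI B0').
transitivity (O * (B * q^`()) - (2 * nu - 1)%:P * 'X * (B * q)); first by ring.
rewrite -E -E'.
transitivity (A * O * (O * (p k)^`(2) - (2 * nu + 1)%:P * 'X * (p k)^`() + B * p k)
   - B * (A * O * p k)); last by rewrite ode; ring.
rewrite polyCB polyCD polyC1 polyCM !polyC_natr; ring.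
Qed.
End positive_index.

Variable N : nat.

Definition wcoef m n t : R := gcoef nu (m - t) (n - t) (N%:Z - m - n + t) t.

(** Common shape of all terms of the relations. The range reaches t = N + 1 because the neighbours m
    + 1 and n + 1 may equal N + 1. *)
Definition gegen_sum m (X Y : int -> R) : {poly R} :=
  \sum_(t < N.+2) ((X t%:Z)%:P * p (m - 2 * t%:Z + 1)
                   + (Y t%:Z)%:P * p (m - 2 * t%:Z - 1)).

Lemma gegen_sumD m X Y X' Y' : gegen_sum m X Y + gegen_sum m X' Y' =
  gegen_sum m (fun t => X t + X' t) (fun t => Y t + Y' t).
Proof.
rewrite /gegen_sum -big_split; apply: eq_bigr => t _ /=; rewrite !polyCD; ring.
Qed.

Lemma gegen_sumZ c m X Y : c%:P * gegen_sum m X Y =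
  gegen_sum m (fun t => c * X t) (fun t => c * Y t).
Proof.
rewrite /gegen_sum mulr_sumr; apply: eq_bigr => t _ /=; rewrite !polyCM; ring.
Qed.

Lemma gegen_sumN m X Y : - gegen_sum m X Y = gegen_sum m (fun t => - X t) (fun t =>
  - Y t).
Proof.
rewrite /gegen_sum -sumrN; apply: eq_bigr => t _ /=; rewrite !polyCN; ring.
Qed.

(** Shifting t by one in the [Y] part collects the coefficient X t + Y (t - 1) of p_{m-2t+1}. The
    merged sum runs over t <= N + 2 and has one extra term at each end; the first two premises
    account for these. *)
Lemma eq_gegen_sum m X Y X' Y' :
  Y (-1) = Y' (-1) -> X N.+2%:Z = X' N.+2%:Z ->
  (forall t, X t + Y (t - 1) = X' t + Y' (t - 1)) ->
  gegen_sum m X Y = gegen_sum m X' Y'.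
Proof.
move=> Y1 XN XY.
suff E Z T : gegen_sum m Z T = \sum_(t < N.+3)
    (Z t%:Z + T (t%:Z - 1))%:P * p (m - 2 * t%:Z + 1)
    - (T (-1))%:P * p (m + 1) - (Z N.+2%:Z)%:P * p (m - 2 * N.+2%:Z + 1).
  by rewrite !E Y1 XN; under eq_bigr do rewrite XY.
under [X in _ = X - _ - _]eq_bigr do rewrite polyCD mulrDl.
rewrite /gegen_sum !big_split /= [X in _ = X + _ - _ - _]big_ord_recr [X in _ + X - _ -
  _]big_ord_recl /=.
have -> : m - 2 * 0%:Z + 1 = m + 1 by lia.
have -> : 0%:Z - 1 = -1 by [].
under [X in _ = _ + (_ + X) - _ - _]eq_bigr => t _.
  rewrite (_ : (bump 0 t)%:Z - 1 = t%:Z); last by rewrite /bump; lia.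
  rewrite (_ : m - 2 * (bump 0 t)%:Z + 1 = m - 2 * t%:Z - 1); last by rewrite /bump;
    lia.
  over.
by ring.
Qed.

(** Each end of the summation range is a zero of one factor of [gcoef], so summing over all
    [t < N.+2] changes nothing. *)
Lemma wcoef_outside m n t :
  [|| t < 0, m < t, n < t | N%:Z + t < m + n] -> wcoef m n t = 0.
Proof.
rewrite /wcoef /gcoef => /or4P[] h.
- by rewrite (inv_fact_lt0 R h) mulr0 !mul0r.
- by rewrite poch_fact_lt0 ?mul0r// subr_lt0.
- by rewrite (@poch_fact_lt0 _ _ (n - t)) ?mulr0 ?mul0r// subr_lt0.
- by rewrite (@inv_fact_lt0 _ (N%:Z - m - n + t)) ?mulr0 ?mul0r//; lia.
Qed.

Lemma wcoefC m n t : wcoef m n t = wcoef n m t.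
Proof. by rewrite /wcoef gcoefC; congr gcoef; lia. Qed.

(** The polynomial a_{m,n} without the factor m! n! (N - m)! (N - n)!. It makes sense for all
    integers m and n, so neighbours outside the matrix are covered; [vsum] is h_{m,n} in the same
    normalization. *)
Definition wsum m n : {poly R} := \sum_(t < N.+2)
  (wcoef m n t%:Z * ((m + n - 2 * t%:Z)%:~R + nu))%:P * p (m + n - 2 * t%:Z).

Definition vsum m n : {poly R} := \sum_(t < N.+2)
  (wcoef m n t%:Z / 2)%:P * (p (m + n - 2 * t%:Z - 1) - p (m + n - 2 * t%:Z + 1)).

Lemma ahatC m n : wsum m n = wsum n m.
Proof. by apply: eq_bigr => t _; rewrite wcoefC (addrC m). Qed.
Lemma hhatC m n : vsum m n = vsum n m.
Proof. by apply: eq_bigr => t _; rewrite wcoefC (addrC m). Qed.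

Lemma hhat_gsum m n : vsum m n =
  gegen_sum (m + n) (fun t => - (wcoef m n t / 2)) (fun t => wcoef m n t / 2).
Proof. by apply: eq_bigr => t _; rewrite polyCN; ring. Qed.

Let kk m n t : R := (m + n - 2 * t)%:~R.

Lemma mulX_ahat m n : 'X * wsum m n =
  gegen_sum (m + n) (fun t => wcoef m n t * (kk m n t + 2 * nu) / 2)
               (fun t => wcoef m n t * kk m n t / 2).
Proof.
rewrite mulr_sumr; apply: eq_bigr => t _ /=.
(* A negative index m + n - 2t forces t > m or t > n, where the coefficient is zero; the recurrence
   is applied only for k >= 0. *)
have [k0|k0] := lerP 0 (m + n - 2 * t%:Z); last first.
  by rewrite wcoef_outside; [rewrite !mul0r; ring | lia].
have h2 : (2 : R) != 0 by rewrite pnatr_eq0.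
rewrite -/(kk m n t).
transitivity ((wcoef m n t / 2)%:P * ((2 * (kk m n t + nu))%:P * 'X * p (m + n - 2 *
  t%:Z))).
  rewrite !mulrA -polyCM (_ : _ / 2 * _ = wcoef m n t * (kk m n t + nu)); last by field.
  by ring.
rewrite (gegenz_rec k0) mulrDr !mulrA -!polyCM.
by congr (_%:P * _ + _%:P * _); rewrite /kk; field.
Qed.

Lemma deriv_ahat m n : O * (wsum m n)^`() =
  gegen_sum (m + n) (fun t => - (wcoef m n t * kk m n t * (kk m n t + 2 * nu) / 2))
               (fun t => wcoef m n t * kk m n t * (kk m n t + 2 * nu) / 2).
Proof.
rewrite /wsum raddf_sum mulr_sumr; apply: eq_bigr => t _ /=.
have [k0|k0] := lerP 0 (m + n - 2 * t%:Z); last first.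
  by rewrite wcoef_outside; [rewrite !mul0r deriv0; ring | lia].
have h2 : (2 : R) != 0 by rewrite pnatr_eq0.
rewrite derivM derivC mul0r add0r -/(kk m n t).
transitivity ((wcoef m n t / 2)%:P * ((2 * (kk m n t + nu))%:P * O * (p (m + n - 2 *
  t%:Z))^`())).
  rewrite ![in RHS]mulrA -polyCM (_ : _ / 2 * _ = wcoef m n t * (kk m n t + nu));
    last by field.
  by ring.
rewrite (gegenz_deriv k0) -/(kk m n t) mulrA -polyCM polyCN.
rewrite (_ : _ / 2 * _ = wcoef m n t * kk m n t * (kk m n t + 2 * nu) / 2);
  last by field.
by ring.
Qed.

Lemma ahat_gsumS m n : wsum (m + 1) n =
  gegen_sum (m + n) (fun t => wcoef (m + 1) n t * (kk m n t + 1 + nu)) (fun=> 0).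
Proof.
apply: eq_bigr => t _ /=; rewrite mul0r addr0 /kk.
have -> : m + 1 + n - 2 * t%:Z = m + n - 2 * t%:Z + 1 by lia.
by rewrite [in LHS]intrD.
Qed.

Lemma ahat_gsumP m n : wsum (m - 1) n =
  gegen_sum (m + n) (fun=> 0) (fun t => wcoef (m - 1) n t * (kk m n t - 1 + nu)).
Proof.
apply: eq_bigr => t _ /=; rewrite mul0r add0r /kk.
have -> : m - 1 + n - 2 * t%:Z = m + n - 2 * t%:Z - 1 by lia.
by rewrite [in LHS]intrB.
Qed.

Lemma ahat_gsumS' m n : wsum m (n + 1) =
  gegen_sum (m + n) (fun t => wcoef m (n + 1) t * (kk m n t + 1 + nu)) (fun=> 0).
Proof.
rewrite ahatC ahat_gsumS (addrC n); apply: eq_bigr => t _.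
by rewrite wcoefC /kk (addrC n m).
Qed.

Lemma ahat_gsumP' m n : wsum m (n - 1) =
  gegen_sum (m + n) (fun=> 0) (fun t => wcoef m (n - 1) t * (kk m n t - 1 + nu)).
Proof.
rewrite ahatC ahat_gsumP (addrC n); apply: eq_bigr => t _.
by rewrite wcoefC /kk (addrC n m).
Qed.

Let shift_args m n t :
  [/\ wcoef m n (t - 1) = gcoef nu (m - t + 1) (n - t + 1) (N%:Z - m - n + t - 1)
    (t - 1),
      wcoef (m + 1) n t = gcoef nu (m - t + 1) (n - t) (N%:Z - m - n + t - 1) t,
      wcoef m (n + 1) t = gcoef nu (m - t) (n - t + 1) (N%:Z - m - n + t - 1) t,
      wcoef (m - 1) n (t - 1) = gcoef nu (m - t) (n - t + 1) (N%:Z - m - n + t) (t - 1)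
    & wcoef m (n - 1) (t - 1) = gcoef nu (m - t + 1) (n - t) (N%:Z - m - n + t)
      (t - 1)].
Proof. by split; rewrite /wcoef; congr gcoef; lia. Qed.

Section relations.
Variables m n : int.
Hypothesis (mN : m <= N) (nN : n <= N).

Let cgN1 m' n' : wcoef m' n' (-1) = 0.
Proof. by rewrite wcoef_outside. Qed.
Let cgN2 m' n' : m' <= N%:Z + 1 -> n' <= N%:Z + 1 -> wcoef m' n' N.+2%:Z = 0.
Proof. by move=> h1 h2; rewrite wcoef_outside//; lia. Qed.

(** Without the factorials the neighbour m - 1 carries N - m + 1 in place of m, and in the next
    relations m + 1 carries m + 1 in place of N - m. *)
Lemma ahat_relB : O * (wsum m n)^`() =
  (N%:R - m%:~R + 1)%:P * wsum (m - 1) n + (N%:R - n%:~R + 1)%:P * wsum m (n - 1)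
  - (m%:~R + n%:~R)%:P * ('X * wsum m n).
Proof.
rewrite deriv_ahat mulX_ahat ahat_gsumP ahat_gsumP' !gegen_sumZ ?gegen_sumN !gegen_sumD.
apply: eq_gegen_sum => [||t]; rewrite ?cgN1 ?cgN2; [ring|ring|lia|lia|].
case: (shift_args m n t) => -> _ _ -> ->; rewrite /wcoef /kk.
by have := gcoef_relB nu0 (m - t) (n - t) (N%:Z - m - n + t) t; lra.
Qed.
Lemma ahat_relH :
  (2 * m%:~R - N%:R)%:P * ('X * wsum m n) + (m%:~R + 1)%:P * wsum (m + 1) n
  - (N%:R - m%:~R + 1)%:P * wsum (m - 1) n =
  ((n%:~R - m%:~R) * (N%:R + 2 * nu))%:P * vsum m n.
Proof.
rewrite mulX_ahat ahat_gsumP ahat_gsumS hhat_gsum !gegen_sumZ ?gegen_sumN !gegen_sumD.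
apply: eq_gegen_sum => [||t]; rewrite ?cgN1 ?cgN2; [ring|ring|lia..|].
case: (shift_args m n t) => -> -> _ -> _; rewrite /wcoef /kk.
by have := gcoef_relH nu0 (m - t) (n - t) (N%:Z - m - n + t) t; lra.
Qed.

Lemma ahat_relS :
  (n%:~R + 1)%:P * wsum m (n + 1) + (N%:R - n%:~R + 1)%:P * wsum m (n - 1)
  - (m%:~R + 1)%:P * wsum (m + 1) n - (N%:R - m%:~R + 1)%:P * wsum (m - 1) n =
  (2 * (m%:~R - n%:~R) * (N%:R - m%:~R - n%:~R))%:P * vsum m n.
Proof.
rewrite ahat_gsumP ahat_gsumP' ahat_gsumS ahat_gsumS'.
rewrite hhat_gsum !gegen_sumZ ?gegen_sumN !gegen_sumD.
apply: eq_gegen_sum => [||t]; rewrite ?cgN1 ?cgN2; [ring|ring|lia..|].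
case: (shift_args m n t) => -> -> -> -> ->; rewrite /wcoef /kk.
by have := gcoef_relS nu0 (m - t) (n - t) (N%:Z - m - n + t) t; lra.
Qed.
End relations.
End gegenbauer_expansion.

(** * Relations with the factorials restored *)

Section weight_polynomials.
Variables (R : realType) (nu : R).
Hypothesis nu0 : 0 < nu.
Variable N : nat.
Implicit Types m n : nat.
Local Notation O := (1 - 'X ^+ 2 : {poly R}).
Local Notation ahat := (wsum nu N).
Local Notation hhat := (vsum nu N).

Let fac m : R := (m`! * (N - m)`!)%:R.

Definition wpoly m n : {poly R} := (fac m * fac n)%:P * ahat m n.
Definition vpoly m n : {poly R} := (fac m * fac n)%:P * hhat m n.

Lemma wpolyC m n : wpoly m n = wpoly n m.
Proof. by rewrite /wpoly (ahatC nu0) [fac m * _]mulrC. Qed.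
Lemma vpolyC m n : vpoly m n = vpoly n m.
Proof. by rewrite /vpoly (hhatC nu0) [fac m * _]mulrC. Qed.

Let ahat_out (m n : int) : m = -1 \/ m = N%:Z + 1 -> ahat m n = 0.
Proof.
move=> h; rewrite /wsum big1// => t _.
rewrite (wcoef_outside nu0) ?mul0r//; lia.
Qed.

(** For m < N this is (N - m) (m + 1)! (N - m - 1)! = (m + 1) m! (N - m)! / (m + 1) * (m + 1) up to
    common factors; for m = N both sides vanish, the right one because [ahat] is zero at N + 1. *)
Lemma wpolyS m n : (m <= N)%N ->
  (N - m)%:R%:P * wpoly m.+1 n = (fac m * fac n)%:P * (m%:R + 1)%:P * ahat (m%:Z + 1) n.
Proof.
rewrite leq_eqVlt => /orP[/eqP->|mN].
  by rewrite subnn mul0r ahat_out ?mulr0//; right.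
have e : (N - m)%:R * fac m.+1 = (m%:R + 1) * fac m :> R.
  rewrite natr1 /fac; have -> : (N - m = (N - m.+1).+1)%N by lia.
  by rewrite !factS !natrM; ring.
rewrite /wpoly (_ : m.+1%:Z = m%:Z + 1); last by lia.
by rewrite mulrA -!polyCM mulrA e; congr (_%:P * _); ring.
Qed.

Lemma wpolyP m n : (m <= N)%N ->
  m%:R%:P * wpoly m.-1 n = (fac m * fac n)%:P * (N%:R - m%:R + 1)%:P * ahat (m%:Z - 1)
    n.
Proof.
case: m => [_|m mN].
  by rewrite mul0r ahat_out ?mulr0//; left.
have e : m.+1%:R * fac m = (N%:R - m.+1%:R + 1) * fac m.+1 :> R.
  rewrite -natrB// natr1 /fac; have -> : (N - m = (N - m.+1).+1)%N by lia.
  by rewrite !factS !natrM; ring.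
rewrite /wpoly /= (_ : m.+1%:Z - 1 = m%:Z); last by lia.
by rewrite mulrA -!polyCM mulrA e; congr (_%:P * _); ring.
Qed.

Section relations.
Variables m n : nat.
Hypothesis (mN : (m <= N)%N) (nN : (n <= N)%N).
Let mNz : m%:Z <= N%:Z. Proof. by rewrite lez_nat. Qed.
Let nNz : n%:Z <= N%:Z. Proof. by rewrite lez_nat. Qed.

Lemma wpoly_relB : O * (wpoly m n)^`() =
  m%:R%:P * wpoly m.-1 n + n%:R%:P * wpoly m n.-1 - (m + n)%:R%:P * ('X * wpoly m n).
Proof.
rewrite (wpolyC m n.-1) (wpolyP _ mN) (wpolyP _ nN) /wpoly derivM derivC mul0r add0r.
rewrite (ahatC nu0 N (n%:Z - 1) m%:Z) mulrCA (ahat_relB nu0 mNz nNz) -!pmulrn.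
rewrite (mulrC (fac n)) natrD.
ring.
Qed.

Lemma wpoly_relH :
  (2 * m%:R - N%:R)%:P * ('X * wpoly m n) + (N - m)%:R%:P * wpoly m.+1 n
  - m%:R%:P * wpoly m.-1 n = ((n%:R - m%:R) * (N%:R + 2 * nu))%:P * vpoly m n.
Proof.
rewrite (wpolyP _ mN) (wpolyS _ mN) /wpoly /vpoly [RHS]mulrCA.
rewrite (pmulrn 1 m) (pmulrn 1 n) -(ahat_relH nu0 mNz nNz).
ring.
Qed.

Lemma wpoly_relS :
  (N - n)%:R%:P * wpoly m n.+1 + n%:R%:P * wpoly m n.-1
  - (N - m)%:R%:P * wpoly m.+1 n - m%:R%:P * wpoly m.-1 n
  = (2 * (m%:R - n%:R) * (N%:R - m%:R - n%:R))%:P * vpoly m n.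
Proof.
rewrite (wpolyC m n.-1) (wpolyC m n.+1) (wpolyP _ mN) (wpolyS _ mN).
rewrite (wpolyP _ nN) (wpolyS _ nN) /vpoly [RHS]mulrCA (mulrC (fac n)).
rewrite (ahatC nu0 N (n%:Z - 1) m%:Z) (ahatC nu0 N (n%:Z + 1) m%:Z).
rewrite (pmulrn 1 m) (pmulrn 1 n) -(ahat_relS nu0 mNz nNz).
ring.
Qed.

Hypothesis mn : m != n.

Lemma vpoly_root x : x ^+ 2 = 1 -> (vpoly m n).[x] = 0.
Proof.
move=> x1; rewrite /vpoly hornerM /vsum horner_sum big1 ?mulr0// => t _.
(* Since m != n, an index m + n - 2t <= 0 forces t above the smaller of m and n, where [wcoef]
   vanishes. So only k > 0 matters. *)
have [k0|k0] := ltrP 0 (m%:Z + n%:Z - 2 * t%:Z).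
  by rewrite hornerM (gegenz_diff_root nu0 k0 x1) mulr0.
by rewrite (wcoef_outside nu0) ?mul0r ?horner0//; move: mn; lia.
Qed.

Lemma vpoly_ode :
  O * (vpoly m n)^`() - (2 * nu - 1)%:P * 'X * vpoly m n = - (O * wpoly m n).
Proof.
rewrite /vpoly /wpoly derivM derivC mul0r add0r.
have E : O * (hhat m n)^`() - (2 * nu - 1)%:P * 'X * hhat m n = - (O * ahat m n).
  rewrite /vsum /wsum raddf_sum /= !mulr_sumr -!sumrN -big_split.
  apply: eq_bigr => t _ /=.
  have [k0|k0] := ltrP 0 (m%:Z + n%:Z - 2 * t%:Z).
    rewrite derivM derivC mul0r add0r.
    rewrite (_ : _ * (_ + nu) = wcoef nu N m n t / 2 * (2 * ((m%:Z + n%:Z - 2 *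
      t%:Z)%:~R + nu))).
      have := gegenz_diff_ode nu0 k0; rewrite [(_ * (2 * _))%:P]polyCM.
      set q := gegenz _ _ - _ => E.
      transitivity ((wcoef nu N m n t / 2)%:P * (O * q^`() - (2 * nu - 1)%:P * 'X * q)).
        by ring.
      by rewrite E; ring.
    by field.
  by rewrite (wcoef_outside nu0) ?mul0r ?deriv0 ?mul0r ?mulr0 ?subr0 ?oppr0//;
    move: mn; lia.
transitivity ((fac m * fac n)%:P * (O * (hhat m n)^`()
  - (2 * nu - 1)%:P * 'X * hhat m n)).
  by ring.
by rewrite E; ring.
Qed.
End relations.
End weight_polynomials.

(** * Identification with the weight as defined *)

Section weight_entries.
Variables (R : realType) (nu : R).
Hypothesis nu0 : 0 < nu.
Variable N : nat.
Implicit Types m n t : nat.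

(** The factor (-k)_j is zero for j > k, so the partial sums are eventually constant. *)
Lemma hyp2F1_hyp_poly (k : nat) (z : R) :
  hyp2F1 (- k%:R) (k%:R + 2 * nu) (nu + 2^-1) z = (hyp_poly nu k).[z].
Proof.
rewrite /hyp2F1; apply: lim_near_cst => //; near=> M.
have kM : (k.+1 <= M)%N by near: M; exact: nbhs_infty_ge.
rewrite /series /= (big_cat_nat (n := k.+1)) //= [X in _ + X]big1_seq ?addr0.
  by rewrite horner_poly big_mkord.
move=> i; rewrite mem_index_iota => /andP[_ /andP[ki _]].
by rewrite (poch_neg R ki) !mul0r.
Unshelve. all: by end_near. Qed.

Lemma gegenbauerE k x :
  gegenbauer nu k x = poch (2 * nu) k / k`!%:R * (gegen nu k).[x].
Proof.
rewrite /gegenbauer hyp2F1_hyp_poly /gegen horner_comp; congr (_ * _.[_]).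
by rewrite hornerZ hornerD hornerN hornerX -polyC1 hornerC.
Qed.

Lemma poch_neg_fact (d s : nat) : (s <= d)%N ->
  poch (- d%:R : R) s = (-1) ^+ s * (d`!%:R / (d - s)`!%:R).
Proof.
elim: s => [_|s IH sd].
  by rewrite poch0 expr0 subn0 mul1r divff// pnatr_eq0 -lt0n fact_gt0.
rewrite pochS IH 1?ltnW// exprS.
have -> : (d - s = (d - s.+1).+1)%N by lia.
rewrite factS natrM (_ : - d%:R + s%:R = - (d - s.+1).+1%:R :> R); last first.
  by rewrite -subSn// subSS natrB 1?ltnW// opprB addrC.
by field; rewrite ?nat1r ?pnatr_eq0 -?lt0n ?fact_gt0.
Qed.

(** Turns (-N - nu)_t into a constant over (nu)_{N-t+1}, which is the factor
    [inv_poch nu (i + j + s + 1)] of [gcoef] because i + j + s = N - t. *)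
Lemma poch_reflect t : (t <= N)%N ->
  (-1) ^+ t * poch (- N%:R - nu) t * poch nu (N - t).+1 = poch nu N.+1.
Proof.
elim: t => [_|t IH tN].
  by rewrite expr0 poch0 subn0 !mul1r.
rewrite -IH 1?ltnW// exprS pochS.
have -> : (N - t = (N - t.+1).+1)%N by lia.
rewrite [in RHS]pochS (_ : (N - t.+1).+1%:R = N%:R - t%:R :> R); first by ring.
by rewrite -subSn// subSS natrB// ltnW.
Qed.

(** The constant left over from alpha_t: (nu)_{N+1} comes from [poch_reflect], the rest is the last
    factor of the definition. *)
Definition wconst : R := poch nu N.+1 * (N%:R + nu) / N`!%:R.

Lemma walpha_gegenbauer m n t x :
  (t <= m)%N -> (m <= n)%N -> (n <= N)%N -> (n + m <= N + t)%N ->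
  walpha N nu t m n * gegenbauer nu (m + n - 2 * t) x =
  wconst * (m`! * (N - m)`!)%:R * (n`! * (N - n)`!)%:R *
   (wcoef nu N m n t * ((m%:Z + n%:Z - 2 * t%:Z)%:~R + nu))
     * (gegenz nu (m%:Z + n%:Z - 2 * t%:Z)).[x].
Proof.
move=> tm mn nN nmN.
have -> : m%:Z + n%:Z - 2 * t%:Z = (m + n - 2 * t)%N%:Z by lia.
rewrite /walpha gegenbauerE /= /wcoef /gcoef.
have -> : m%:Z - t%:Z = (m - t)%N%:Z by lia.
have -> : n%:Z - t%:Z = (n - t)%N%:Z by lia.
have -> : N%:Z - m%:Z - n%:Z + t%:Z = (N + t - (n + m))%N%:Z by lia.
have -> : (m - t)%N%:Z + (n - t)%N%:Z + t%:Z + 1 = (n + m - t).+1%:Z by lia.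
have -> : (m - t)%N%:Z + (n - t)%N%:Z + (N + t - (n + m))%N%:Z + 1 = (N - t).+1%:Z by
  lia.
rewrite !inv_fact_nat /poch_fact /inv_poch -!pmulrn.
rewrite -opprB -natrB// poch_neg_fact; last by lia.
have -> : (N - n - (m - t) = N + t - (n + m))%N by lia.
rewrite /wconst -(poch_reflect (t := t)); last by lia.
(* The sign (-1)^m splits: (-1)^(m-t) cancels against the sign of (n - N)_{m-t}, and (-1)^t against
   that of [poch_reflect]. The denominator n + m - t + nu completes (nu)_{n+m-t} to
   (nu)_{n+m-t+1}. *)
rewrite -[X in (-1) ^+ X](subnK tm) exprD (addnC n m)
  [poch nu (m + n - t).+1]pochS !natrM.
have : (-1) ^+ (m - t) * (-1) ^+ (m - t) = 1 :> R by rewrite -expr2 sqrr_sign.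
set e := (-1) ^+ (m - t) => e2.
have f0 (k : nat) : k`!%:R != 0 :> R by rewrite pnatr_eq0 -lt0n fact_gt0.
have p0 (k : nat) : poch nu k != 0 by exact: poch_neq0.
have q0 (k : nat) : poch (2 * nu) k != 0 by rewrite poch_neq0// mulr_gt0.
have d0 (k : nat) : k%:R + nu != 0 by rewrite gt_eqF// ltr_wpDl.
move: (f0 m) (f0 n) (f0 t) (f0 N) (f0 (N - m)%N) (f0 (N - n)%N) (f0 (n - t)%N).
move: (f0 (m - t)%N) (f0 (m + n - 2 * t)%N) (f0 (N + t - (m + n))%N).
move: (p0 (m + n - t)%N) (p0 (N - t).+1) (q0 (m + n - 2 * t)%N) (d0 (m + n - t)%N).
rewrite (addrC nu).
move: (m + n - t)%N (m + n - 2 * t)%N (N - t).+1 (N + t - (m + n))%N (N - m)%N (N -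
  n)%N.
move: (n - t)%N (m - t)%N e e2 => a b e e2 c d f g' h i *.
transitivity (e * e * ((-1) ^+ t * poch (1 *- N - nu) t * poch nu f * (N%:R + nu) /
  N`!%:R * (m`!%:R * h`!%:R) * (n`!%:R * i`!%:R) *
  (poch nu b / b`!%:R * (poch nu a / a`!%:R) /
   g'`!%:R / t`!%:R / (poch nu c * (c%:R + nu)) /
   poch nu f * (d%:R + nu)) * (gegen nu d).[x])); last by rewrite e2 mul1r.
move: (poch (1 *- N - nu) t) (gegen nu d).[x] => X Y.
by field; do ?[apply/andP; split].
Qed.
Lemma weight_upperE x m n : (m <= n)%N -> (n <= N)%N ->
  weight_upper N nu x m n =
  (1 - x ^+ 2) `^ (nu - 2^-1) * (wconst * (wpoly nu N m n).[x]).
Proof.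
move=> mn nN; rewrite /weight_upper; congr (_ * _).
rewrite /wpoly /wsum hornerM hornerC horner_sum !mulr_sumr.
rewrite -(big_mkord xpredT (fun t : nat => wconst *
  ((m`! * (N - m)`!)%:R * (n`! * (N - n)`!)%:R *
   ((wcoef nu N m n t%:Z * ((m%:Z + n%:Z - 2 * t%:Z)%:~R + nu))%:P *
     gegenz nu (m%:Z + n%:Z - 2 * t%:Z)).[x]))).
(* The range in the definition of the weight contains every t with a nonzero coefficient, so both
   ends of the long sum can be cut off. *)
have outside t : (N + t < m + n)%N || (m < t)%N ->
    wconst * ((m`! * (N - m)`!)%:R * (n`! * (N - n)`!)%:R *
   ((wcoef nu N m n t%:Z * ((m%:Z + n%:Z - 2 * t%:Z)%:~R + nu))%:P *
     gegenz nu (m%:Z + n%:Z - 2 * t%:Z)).[x]) = 0.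
  move=> h; rewrite (wcoef_outside nu0) ?mul0r ?horner0 ?mulr0//; lia.
rewrite [RHS](big_cat_nat (n := n + m - N)) //=; last by lia.
rewrite [X in _ = X + _]big1_seq ?add0r; last first.
  move=> t; rewrite mem_index_iota => /andP[_ /andP[_ h]]; apply: outside; lia.
rewrite [RHS](big_cat_nat (n := m.+1)) //=; [|lia|lia].
rewrite [X in _ = _ + X]big1_seq ?addr0; last first.
  move=> t; rewrite mem_index_iota => /andP[_ /andP[h _]]; apply: outside; lia.
apply: eq_big_nat => t /andP[h1 h2].
by rewrite walpha_gegenbauer//; [rewrite hornerM hornerC; ring|lia].
Qed.

Definition rweight x : 'M[R]_N.+1 := \matrix_(m, n)
  ((1 - x ^+ 2) `^ (nu - 2^-1) * (wconst * (wpoly nu N m n).[x])).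

Lemma weightE x : weight N nu x = map_mx (real_complex R) (rweight x).
Proof.
apply/matrixP => m n; rewrite !mxE; case: leqP => mn.
  by rewrite weight_upperE// -ltnS.
by rewrite weight_upperE ?(wpolyC nu0 N n m) ?(ltnW mn) -1?ltnS.
Qed.

End weight_entries.

Local Open Scope classical_set_scope.
Local Open Scope ring_scope.
Local Open Scope complex_scope.
Local Open Scope sesquilinear_scope.

(** * The coefficient matrices *)

Section operator_matrices.
Variables (R : realType) (N : nat).
Hypothesis N0 : (0 < N)%N.
Implicit Types (x nu : R) (i j : 'I_N.+1).
Local Notation M := 'M[R]_N.+1.
Local Notation RC := (real_complex R).

Definition raise_mx : M := \matrix_(i, j) ((N - i)%:R *+ (j == i.+1 :> nat)).
Definition lower_mx : M := \matrix_(i, j) (i%:R *+ (j.+1 == i)).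
Definition cartan_mx : M := diag_mx (\row_i (N%:R - 2 * i%:R)).

(** [inord] sends an index that is out of range to 0; the bounds on [hi] and [s] exclude this. *)
Lemma sum_delta (K : fieldType) (c : nat -> K) (s : nat -> nat) lo hi i j :
  (hi <= N.+1)%N -> (forall k, (lo <= k < hi)%N -> (s k <= N)%N) ->
  (\sum_(lo <= k < hi) c k *: (delta_mx (inord k) (inord (s k)) : 'M[K]_N.+1)) i j
  = c i *+ ((lo <= i < hi)%N && (s i == j)).
Proof.
move=> hiN sN; rewrite summxE.
have E k : (lo <= k < hi)%N ->
    (c k *: (delta_mx (inord k) (inord (s k)) : 'M[K]_N.+1)) i j =
    if k == i then c i *+ (s i == j) else 0.
  move=> kr; have /andP[_ kh] := kr; rewrite !mxE -!val_eqE /= !inordK ?ltnS ?sN//;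
    last first.
    by rewrite -ltnS (leq_trans kh).
  rewrite eq_sym (eq_sym (j : nat)); case: eqP => [<-|] /=; last by rewrite mulr0.
  by case: eqP; rewrite ?mulr1 ?mulr0.
rewrite (eq_big_nat _ _ E) -big_mkcond /=.
have [ir|ir] := boolP (lo <= i < hi)%N; last first.
  rewrite big_nat_cond big_pred0// => k; apply/negbTE; apply: contra ir.
  by case/andP => ? /eqP <-.
by rewrite big_nat1_eq ir.
Qed.

Let supE i j : (0 <= i < N)%N && (i.+1 == j) = (j == i.+1 :> nat).
Proof.
rewrite leq0n /= eq_sym; case: eqP => [ji|]; last by rewrite andbF.
by rewrite andbT -ltnS -ji ltn_ord.
Qed.
Let subE i j : (0 < i < N.+1)%N && (i.-1 == j) = (j.+1 == i).
Proof.
rewrite ltn_ord andbT; case: (nat_of_ord i) => [|k] //=.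
by rewrite eqSS eq_sym.
Qed.

Let sum_raise i j :
  (\sum_(0 <= k < N) (N - k)%:R *: (delta_mx (inord k) (inord k.+1) : 'M[R[i]]_N.+1))
    i j
  = RC (raise_mx i j).
Proof.
by rewrite (@sum_delta _ (fun k => (N - k)%:R) S)// supE mxE rmorphMn rmorph_nat.
Qed.

Let sum_lower i j :
  (\sum_(1 <= k < N.+1) k%:R *: (delta_mx (inord k) (inord k.-1) : 'M[R[i]]_N.+1)) i j
  = RC (lower_mx i j).
Proof.
rewrite (@sum_delta _ (fun k => k%:R) predn)//; last by case=> // k /andP[_ /ltnW].
by rewrite subE mxE rmorphMn rmorph_nat.
Qed.

Let sum_diag (c : nat -> R) i j :
  (\sum_(0 <= k < N.+1) RC (c k) *: (delta_mx (inord k) (inord k) : 'M[R[i]]_N.+1)) i j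
  = RC (diag_mx (\row_(i < N.+1) c i) i j).
Proof.
rewrite (@sum_delta _ (fun k => RC (c k)) id)//.
by rewrite !mxE leq0n ltn_ord /= rmorphMn -val_eqE.
Qed.

Lemma matCE : matC R N = map_mx RC (raise_mx + lower_mx).
Proof.
by apply/matrixP => i j; rewrite /matC 2!mxE sum_raise sum_lower -rmorphD !mxE.
Qed.

Let NR0 : (N%:R : R) != 0.
Proof. by rewrite pnatr_eq0 -lt0n. Qed.

Let ellE : ell R N = RC (N%:R / 2).
Proof. by rewrite /ell rmorphM fmorphV !rmorph_nat. Qed.

Definition rB0 : M := N%:R^-1 *: (raise_mx - lower_mx).
Definition rB1 : M := - N%:R^-1 *: cartan_mx.
(** This is -V, the zeroth-order coefficient of the operator, hence the positive sign. *)
Definition rV : M := diag_mx (\row_i (i%:R * (N%:R - i%:R))).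
Definition rA0 nu : M := N%:R^-1 *:
  diag_mx (\row_i ((N%:R + 2) * (i%:R - N%:R) - (nu - 1) * (N%:R - 2 * i%:R))).

Lemma matB0E : matB0 R N = map_mx RC rB0.
Proof.
apply/matrixP => i j; rewrite /matB0 4!mxE sum_raise [X in _ - X]sum_lower.
rewrite -rmorphB ellE -(rmorph_nat RC) -rmorphM -fmorphV -rmorphM !mxE.
by congr (RC (_^-1 * _)); field.
Qed.

Lemma matB1E : matB1 R N = map_mx RC rB1.
Proof.
rewrite /matB1 (eq_bigr (fun k => RC (N%:R / 2 - k%:R) *: delta_mx (inord k)
  (inord k))).
  apply/matrixP => i j; rewrite 2!mxE sum_diag ellE -rmorphN -fmorphV -rmorphM !mxE.
  congr (RC _); case: (_ == _); rewrite ?mulr1n ?mulr0n; field; exact: NR0.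
by move=> k _; rewrite ellE rmorphB rmorph_nat.
Qed.

Lemma matVE : - matV R N = map_mx RC rV.
Proof.
rewrite /matV opprK (eq_big_nat _ _ (F2 := fun k => RC (k%:R * (N%:R - k%:R))
  *: delta_mx (inord k) (inord k))).
  by apply/matrixP => i j; rewrite sum_diag !mxE.
by move=> k kN; rewrite natrM natrB// rmorphM rmorphB !rmorph_nat.
Qed.

Lemma matA0E nu : matA0 N nu = map_mx RC (rA0 nu).
Proof.
rewrite /matA0 (eq_bigr (fun k => RC ((N%:R / 2 + 1) * (k%:R - N%:R) - (nu - 1)
  * (N%:R / 2 - k%:R)) *: delta_mx (inord k) (inord k))).
  apply/matrixP => i j; rewrite mxE sum_diag ellE -fmorphV -rmorphM !mxE.
  congr (RC _); case: (_ == _); rewrite ?mulr1n ?mulr0n ?mulr0//; field; exact: NR0.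
move=> k _; rewrite ellE !(rmorphB, rmorphM, rmorphD) /= !rmorph_nat rmorph1 /=.
rewrite (_ : 2 * _ = N%:R) // mulrCA -(rmorph_nat RC 2) -rmorphM mulfV.
  by rewrite rmorph1 mulr1.
by rewrite pnatr_eq0.
Qed.

Definition rF2 x : R := 1 - x ^+ 2.
Definition rF1 nu x : M := raise_mx + lower_mx - (x * (N%:R + 2 * nu + 1))%:M.
Definition rG1 x : M := x *: rB1 + rB0.

Lemma opD2E nu x : dcoef2 (opD N nu) x = map_mx RC (rF2 x)%:M.
Proof. by rewrite map_scalar_mx. Qed.

Lemma opD1E nu x : dcoef1 (opD N nu) x = map_mx RC (rF1 nu x).
Proof.
rewrite /= matCE map_mxB map_scalar_mx; congr (_ - _%:M).
rewrite ellE !(rmorphM, rmorphD) /= !rmorph_nat rmorph1 /=.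
rewrite (_ : 2 * (_ * _) = N%:R) // mulrCA -(rmorph_nat RC 2) -rmorphM mulfV.
  by rewrite rmorph1 mulr1.
by rewrite pnatr_eq0.
Qed.

Lemma opD0E nu x : dcoef0 (opD N nu) x = map_mx RC rV.
Proof. exact: matVE. Qed.

Lemma opE1E nu x : dcoef1 (opE N nu) x = map_mx RC (rG1 x).
Proof. by rewrite /= matB0E matB1E /rG1 [RHS]map_mxD [in RHS]map_mxZ. Qed.

Lemma opE0E nu x : dcoef0 (opE N nu) x = map_mx RC (rA0 nu).
Proof. exact: matA0E. Qed.

Lemma sum_raise_mx i (f : nat -> R) :
  \sum_j raise_mx i j * f j = (N - i)%:R * f i.+1.
Proof.
have [iN|iN] := ltnP i N.
  have iN' : (i.+1 < N.+1)%N by rewrite ltnS.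
  rewrite (bigD1 (Ordinal iN')) //= mxE eqxx mulr1n big1 ?addr0// => j.
  by rewrite -val_eqE /= mxE => /negbTE ->; rewrite mulr0n mul0r.
rewrite big1 => [|j _].
  by have -> : (N - i)%N = 0%N; [apply/eqP; rewrite subn_eq0|rewrite mul0r].
rewrite mxE ltn_eqF ?mulr0n ?mul0r//.
by rewrite (leq_trans (ltn_ord j))// ltnS.
Qed.

Lemma sum_lower_mx i (f : nat -> R) :
  \sum_j lower_mx i j * f j = i%:R * f i.-1.
Proof.
have [i0|i0] := posnP i.
  by rewrite big1 => [|j _]; rewrite ?mxE i0 ?mul0r// mulr0n mul0r.
have iN' : (i.-1 < N.+1)%N by rewrite prednK// ltnW.
rewrite (bigD1 (Ordinal iN')) //= mxE /= prednK// eqxx mulr1n big1 ?addr0// => j.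
rewrite -val_eqE /= => /negbTE ji.
by rewrite mxE -(prednK i0) eqSS ji mulr0n mul0r.
Qed.

Lemma raise_lower : raise_mx *m lower_mx - lower_mx *m raise_mx = cartan_mx.
Proof.
apply/matrixP => i j; rewrite 4!mxE.
rewrite (eq_bigr (fun k => raise_mx i k * (k%:R *+ (j.+1 == k :> nat)))); last first.
  by move=> k _; rewrite [lower_mx _ _]mxE.
rewrite (sum_raise_mx i (fun k => k%:R *+ (j.+1 == k))).
rewrite (eq_bigr (fun k => lower_mx i k * ((N - k)%:R *+ (j == k.+1 :> nat))));
  last first.
  by move=> k _; rewrite [raise_mx _ _]mxE.
rewrite (sum_lower_mx i (fun k => (N - k)%:R *+ (j == k.+1 :> nat))).
have -> : i%:R * ((N - i.-1)%:R *+ (j == i.-1.+1 :> nat)) =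
    (i%:R * (N%:R - i%:R + 1)) *+ (j == i) :> R.
  have := ltn_ord i; case: (posnP i) => [i0 _|i0 iN].
    by rewrite -!mulrnAr i0 !mul0r.
  rewrite prednK// mulrnAr natrB; last by rewrite (leq_trans (leq_pred _)).
  rewrite (_ : i.-1%:R = i%:R - 1 :> R); last by rewrite -[in RHS](prednK i0)
    -natr1 addrK.
  by congr (_ * _ *+ _); ring.
rewrite eqSS -val_eqE eq_sym natrB; last by rewrite -ltnS.
by rewrite !mxE -!val_eqE /=; case: (_ == _); rewrite ?mulr1n ?mulr0n -?[i.+1%:R]natr1;
  ring.
Qed.

Lemma cartan_raise : cartan_mx *m raise_mx - raise_mx *m cartan_mx = 2 *: raise_mx.
Proof.
apply/matrixP => i j; rewrite mul_diag_mx mul_mx_diag !mxE.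
by case: eqP => [->|_]; rewrite ?mulr1n ?mulr0n -?natr1; ring.
Qed.

Lemma cartan_lower : cartan_mx *m lower_mx - lower_mx *m cartan_mx = - 2 *: lower_mx.
Proof.
apply/matrixP => i j; rewrite mul_diag_mx mul_mx_diag !mxE.
by case: eqP => [<-|_]; rewrite ?mulr1n ?mulr0n -?natr1; ring.
Qed.

End operator_matrices.

(** * Calculus of derivatives on a set *)

Section derivatives_on.
Variable R : realType.
Implicit Types (A : set R) (f g : R -> R) (x y d : R).

Definition has_derive_on A f x d : Prop :=
  diffquot f x y @[y --> within A x^'] --> d.

(** An interval with nonempty interior contains a segment from x to some z != x, so x is a limit
    point of A. Properness makes limits unique, which is what lets [derive_on] be computed. *)
Lemma within_dnbhs_proper A x :
  is_interval A -> interior A !=set0 -> A x -> ProperFilter (within A x^').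
Proof.
move=> iA [a Aa] Ax; apply: Build_ProperFilter_ex.
have [z Az zx] : exists2 z, A z & z != x.
  have [ax|ax] := eqVneq a x; last by exists a => //; exact: interior_subset Aa.
  have /nbhs_ballP[e /= e0 eA] := Aa.
  exists (a + e / 2); last by rewrite -ax; apply/eqP; lra.
  by apply: eA; rewrite /ball/= opprD addrA subrr sub0r normrN gtr0_norm; lra.
move=> P; rewrite /within/= => /nbhs_ballP[e /= e0 eP].
(* The point x + t (z - x) lies on the segment because t <= 1, and within e / 2 of x by the second
   bound. *)
pose t := Num.min 1 (e / (2 * `|z - x|)).
have zx0 : 0 < `|z - x| by rewrite normr_gt0 subr_eq0.
have t0 : 0 < t by rewrite lt_min ltr01 divr_gt0// mulr_gt0.
have t1 : t <= 1 by rewrite ge_min lexx.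
have te : t * `|z - x| < e.
  have : t <= e / (2 * `|z - x|) by rewrite ge_min lexx orbT.
  by rewrite ler_pdivlMr ?mulr_gt0//; lra.
exists (x + t * (z - x)); apply: eP.
- rewrite /ball/= (_ : _ - _ = - (t * (z - x))); last by ring.
  by rewrite normrN normrM (gtr0_norm t0).
- rewrite -subr_eq0 (_ : _ - _ = t * (z - x)); last by ring.
  by rewrite mulf_eq0 negb_or gt_eqF//= subr_eq0.
- have [xz|zx'] := lerP x z.
    by apply: (iA x z) => //; apply/andP; split; nra.
  by apply: (iA z x) => //; apply/andP; split; nra.
Qed.

Section rules.
Variables (A : set R) (x : R).
Local Notation F := (within A x^').

Let F_neq : \forall y \near F, y != x.
Proof. exact: (@filterS _ _ _ _ _ _ (nbhs_dnbhs_neq x)). Qed.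

Let F_id : y @[y --> F] --> x.
Proof. by move=> P xP; apply: (@filterS _ _ _ _ _ _ (nbhs_dnbhs xP)). Qed.

Let F_A : F A. Proof. exact: withinT. Qed.

Lemma has_derive_on_cvg f d : has_derive_on A f x d -> f y @[y --> F] --> f x.
Proof.
move=> fd.
have : (f x + (y - x) * diffquot f x y) @[y --> F] --> f x + (x - x) * d.
  apply: cvgD; first exact: cvg_cst.
  by apply: cvgM fd; apply: cvgB => //; exact: cvg_cst.
rewrite subrr mul0r addr0; apply: cvg_trans; apply: (@near_eq_cvg _ _ F).
near=> y; rewrite /diffquot mulrC divfK ?subr_eq0; first by rewrite addrC subrK.
by near: y.
Unshelve. all: by end_near. Qed.

Lemma has_derive_onD f g df dg :
  has_derive_on A f x df -> has_derive_on A g x dg ->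
  has_derive_on A (fun y => f y + g y) x (df + dg).
Proof.
move=> hf hg.
have : (diffquot f x y + diffquot g x y) @[y --> F] --> df + dg by exact: cvgD.
apply: cvg_trans; apply: (@near_eq_cvg _ _ F).
by near=> y; rewrite /diffquot /= -mulrDl; congr (_ / _); ring.
Unshelve. all: by end_near. Qed.

Lemma has_derive_onM f g df dg :
  has_derive_on A f x df -> has_derive_on A g x dg ->
  has_derive_on A (fun y => f y * g y) x (df * g x + f x * dg).
Proof.
move=> hf hg.
have : (diffquot f x y * g x + f y * diffquot g x y) @[y --> F] -->
    df * g x + f x * dg.
  apply: cvgD; first by apply: cvgM => //; exact: cvg_cst.
  by apply: cvgM => //; exact: has_derive_on_cvg hf.
apply: cvg_trans; apply: (@near_eq_cvg _ _ F); near=> y.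
by rewrite /diffquot; ring.
Unshelve. all: by end_near. Qed.

Lemma has_derive_on_cst c : has_derive_on A (fun=> c) x 0.
Proof.
have : (0 : R) @[_ --> F] --> (0 : R) by exact: cvg_cst.
 apply: cvg_trans; apply: (@near_eq_cvg _ _ F).
by near=> y; rewrite /diffquot subrr mul0r.
Unshelve. all: by end_near. Qed.

Lemma has_derive_on_id : has_derive_on A id x 1.
Proof.
have : (1 : R) @[_ --> F] --> (1 : R) by exact: cvg_cst.
 apply: cvg_trans; apply: (@near_eq_cvg _ _ F).
near=> y; rewrite /diffquot divff// subr_eq0; by near: y.
Unshelve. all: by end_near. Qed.

Lemma has_derive_on_ext f g d : A x -> {in A, f =1 g} ->
  has_derive_on A f x d -> has_derive_on A g x d.
Proof.
move=> Ax fg; apply: cvg_trans; apply: (@near_eq_cvg _ _ F).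
near=> y; have Ay : A y by near: y; exact: F_A.
by rewrite /diffquot !fg ?inE.
Unshelve. all: by end_near. Qed.

Lemma has_derive_on_sum (I : Type) (r : seq I) (f : I -> R -> R) (df : I -> R) :
  (forall i, has_derive_on A (f i) x (df i)) ->
  has_derive_on A (fun y => \sum_(i <- r) f i y) x (\sum_(i <- r) df i).
Proof.
move=> h; elim: r => [|i r IH].
  rewrite big_nil (_ : (fun _ => _) = fun=> 0); first exact: has_derive_on_cst.
  by apply/funext => y; rewrite big_nil.
rewrite big_cons (_ : (fun _ => _) = fun y => f i y + \sum_(j <- r) f j y).
  exact: has_derive_onD.
by apply/funext => y; rewrite big_cons.
Qed.

Hypothesis Fp : ProperFilter F.

Lemma has_derive_onE f d : has_derive_on A f x d -> derive_on A f x = d.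
Proof. by move=> h; apply: cvg_lim. Qed.

End rules.

End derivatives_on.

Section mx_derivatives_on.
Variable R : realType.
Implicit Types (A : set R) (x y : R).

Definition has_mderive_on p q A (U : R -> 'M[R]_(p, q)) x (D : 'M[R]_(p, q)) : Prop :=
  forall i j, has_derive_on A (fun y => U y i j) x (D i j).

Section rules.
Variables (A : set R) (x : R).

Lemma has_mderive_onD p q (U V : R -> 'M[R]_(p, q)) DU DV :
  has_mderive_on A U x DU -> has_mderive_on A V x DV ->
  has_mderive_on A (fun y => U y + V y) x (DU + DV).
Proof.
move=> hU hV i j; rewrite mxE (_ : (fun y => _) = fun y => U y i j + V y i j).
  exact: has_derive_onD.
by apply/funext => y; rewrite mxE.
Qed.

Lemma has_mderive_onM p q r (U : R -> 'M[R]_(p, q)) (V : R -> 'M[R]_(q, r)) DU DV :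
  has_mderive_on A U x DU -> has_mderive_on A V x DV ->
  has_mderive_on A (fun y => U y *m V y) x (DU *m V x + U x *m DV).
Proof.
move=> hU hV i j; rewrite !mxE -big_split /=.
rewrite (_ : (fun y => _) = fun y => \sum_k U y i k * V y k j).
  by apply: has_derive_on_sum => k; exact: has_derive_onM.
by apply/funext => y; rewrite mxE.
Qed.

Lemma has_mderive_on_cst p q (D : 'M[R]_(p, q)) : has_mderive_on A (fun=> D) x 0.
Proof. by move=> i j; rewrite mxE; exact: has_derive_on_cst. Qed.

Lemma has_mderive_onZ p q (f : R -> R) df (D : 'M[R]_(p, q)) :
  has_derive_on A f x df -> has_mderive_on A (fun y => f y *: D) x (df *: D).
Proof.
move=> hf i j; rewrite mxE (_ : (fun y => _) = fun y => f y * D i j).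
  by have := has_derive_onM hf (has_derive_on_cst A x (D i j)); rewrite mulr0 addr0.
by apply/funext => y; rewrite mxE.
Qed.

Lemma has_mderive_onMr p q r (U : R -> 'M[R]_(p, q)) (D : 'M[R]_(q, r)) DU :
  has_mderive_on A U x DU -> has_mderive_on A (fun y => U y *m D) x (DU *m D).
Proof.
move=> hU; have := has_mderive_onM hU (has_mderive_on_cst D).
by rewrite mulmx0 addr0.
Qed.

Lemma has_mderive_on_tr p q (U : R -> 'M[R]_(p, q)) DU :
  has_mderive_on A U x DU -> has_mderive_on A (fun y => (U y)^T) x DU^T.
Proof.
move=> hU i j; rewrite mxE (_ : (fun y => _) = fun y => U y j i); first exact: hU.
by apply/funext => y; rewrite mxE.
Qed.

Lemma has_mderive_on_ext p q (U V : R -> 'M[R]_(p, q)) D : A x -> {in A, U =1 V} ->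
  has_mderive_on A U x D -> has_mderive_on A V x D.
Proof.
move=> Ax UV hU i j; apply: (has_derive_on_ext Ax) (hU i j) => y Ay.
by rewrite UV.
Qed.
End rules.

Variable n : nat.
Local Notation M := 'M[R]_n.

Definition mderive_on A (U : R -> M) x : M :=
  \matrix_(i, j) derive_on A (fun y => U y i j) x.

Definition mx_act A (F2 F1 F0 : R -> M) (U : R -> M) x : M :=
  mderive_on A (mderive_on A U) x *m F2 x + mderive_on A U x *m F1 x + U x *m F0 x.

Lemma mderive_onE A U x D : ProperFilter (within A x^') ->
  has_mderive_on A U x D -> mderive_on A U x = D.
Proof. by move=> pA h; apply/matrixP => i j; rewrite mxE (has_derive_onE pA (h i j)).
  Qed.

End mx_derivatives_on.

(** * Commutation for real matrix functions *)

Section commute.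
Variables (R : realType) (N : nat) (nu : R).
Hypothesis N0 : (0 < N)%N.
Local Notation M := 'M[R]_N.+1.

Let has_F2 A x : has_mderive_on A (fun y => (rF2 y)%:M : M) x ((- 2 * x)%:M).
Proof.
rewrite -scalemx1 (_ : (fun y => _) = fun y => rF2 y *: 1%:M); last first.
  by apply/funext => y; rewrite scalemx1.
apply: has_mderive_onZ.
have hx := has_derive_on_id A x.
have := has_derive_onD (has_derive_on_cst A x 1)
  (has_derive_onM (has_derive_on_cst A x (-1)) (has_derive_onM hx hx)).
rewrite (_ : _ + _ = -2 * x); last by ring.
by rewrite (_ : (fun y => _) = @rF2 R)//; apply/funext => y; rewrite /rF2; ring.
Qed.

Let has_F1 A x : has_mderive_on A (rF1 N nu) x (- (N%:R + 2 * nu + 1)%:M).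
Proof.
have := has_mderive_onD (@has_mderive_on_cst R A x _ _ (raise_mx R N + lower_mx R N))
  (@has_mderive_onZ R A x _ _ _ _ (- (N%:R + 2 * nu + 1)%:M) (has_derive_on_id A x)).
rewrite add0r scale1r (_ : (fun y => _) = rF1 N nu)//.
by apply/funext => y; rewrite /rF1 scalerN scale_scalar_mx.
Qed.

Let has_G1 A x : has_mderive_on A (@rG1 R N) x (rB1 R N).
Proof.
have := has_mderive_onD (@has_mderive_onZ R A x _ _ _ _ (rB1 R N)
  (has_derive_on_id A x))
  (@has_mderive_on_cst R A x _ _ (rB0 R N)).
by rewrite addr0 scale1r.
Qed.

Local Notation H := (cartan_mx R N).
Local Notation E := (raise_mx R N).
Local Notation F := (lower_mx R N).

Let EF : E *m F = F *m E + H.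
Proof. by rewrite -raise_lower addrC subrK. Qed.
Let HE : H *m E = E *m H + 2 *: E.
Proof. by rewrite -cartan_raise addrC subrK. Qed.
Let HF : H *m F = F *m H - 2 *: F.
Proof. by rewrite -scaleNr -cartan_lower addrC subrK. Qed.
Let HHE : H *m H *m E = E *m H *m H + 4 *: (E *m H) + 4 *: E.
Proof.
rewrite -mulmxA HE mulmxDr mulmxA HE mulmxDl -!scalemxAl -!scalemxAr HE.
move: (E *m H *m H) (E *m H) E => a b c.
by apply/matrixP => i j; rewrite !mxE; ring.
Qed.
Let HHF : H *m H *m F = F *m H *m H - 4 *: (F *m H) + 4 *: F.
Proof.
rewrite -mulmxA HF mulmxBr mulmxA HF mulmxBl -!scalemxAl -!scalemxAr HF.
move: (F *m H *m H) (F *m H) F => a b c.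
by apply/matrixP => i j; rewrite !mxE; ring.
Qed.
(** i (N - i) = (N^2 - (N - 2i)^2) / 4. With [AE] this expresses every coefficient through H, E and
    F, so moving H to the right of E and F decides the identities. *)
Let VE : rV R N = (N%:R ^+ 2 / 4)%:M - 4^-1 *: (H *m H).
Proof.
apply/matrixP => i j; rewrite mul_diag_mx !mxE; case: eqP => [->|_].
  by rewrite !mulr1n; field.
by rewrite !mulr0n; ring.
Qed.
Let AE : rA0 N nu =
  N%:R^-1 *: ((- ((N%:R + 2) / 2 * N%:R))%:M - ((N%:R + 2) / 2 + nu - 1) *: H).
Proof.
apply/matrixP => i j; rewrite !mxE; case: eqP => [->|_].
  by rewrite !mulr1n; congr (_ * _); field.
by rewrite !mulr0n; ring.
Qed.

(** Equality of the coefficients of U'' in (UD)E and (UE)D, where 2 x G1 is - F2' G1. Those of U'''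
    agree because F2 is scalar. *)
Lemma comm_F1_G1 x : rF1 N nu x *m rG1 N x - rG1 N x *m rF1 N nu x =
  2 *: (rF2 x *: rB1 R N) + (2 * x) *: rG1 N x.
Proof.
rewrite /rF1 /rG1 /rB1 /rB0 /rF2.
move: HE HF EF; move: H E F => h e f he hf ef.
rewrite !(mulmxDl, mulmxDr, mulmxN, mulNmx) -?scalemxAr -?scalemxAl.
rewrite !(mulmxDl, mulmxDr, mulmxN, mulNmx) -?scalemxAr -?scalemxAl.
rewrite ?mul_mx_scalar ?mul_scalar_mx he hf ef.
move: (e *m h) (f *m h) (f *m e) (e *m e) (f *m f) (h *m h) => a0 a1 a2 a3 a4 a5.
by apply/matrixP => i j; rewrite !mxE; ring.
Qed.

(** Equality of the coefficients of U'; the scalar -(N + 2 nu + 1) is F1', and B1 is G1'. *)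
Lemma comm_F0 x :
  (- (N%:R + 2 * nu + 1)%:M + rV R N) *m rG1 N x + rF1 N nu x *m rA0 N nu =
  (rB1 R N + rA0 N nu) *m rF1 N nu x + rG1 N x *m rV R N.
Proof.
rewrite VE AE /rF1 /rG1 /rB1 /rB0.
move: HE HF EF HHE HHF; move: H E F => h e f he hf ef hhe hhf.
do 3![rewrite ?(mulmxDl, mulmxDr, mulmxN, mulNmx) -?scalemxAr -?scalemxAl ?mulmxA].
rewrite ?mul_mx_scalar ?mul_scalar_mx ?hhe ?hhf ?he ?hf.
move: (e *m h) (f *m h) (h *m h) (e *m h *m h) (f *m h *m h) (h *m h *m h) =>
  a1 a2 a3 a4 a5 a6.
apply/matrixP => i j; rewrite !mxE; move: (N%:R^-1 : R) => w.
by case: (_ == _); rewrite ?mulr1n ?mulr0n; field.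
Qed.

Lemma comm_VA0 : rV R N *m rA0 N nu = rA0 N nu *m rV R N.
Proof.
rewrite /rV /rA0 -scalemxAr -scalemxAl; congr (_ *: _).
by apply/matrixP => i j; rewrite mul_diag_mx mul_mx_diag !mxE; case: eqP => [->|];
   rewrite ?mulr0n ?mulr1n ?mulr0 ?mul0r// mulrC.
Qed.

Lemma real_commute (A : set R) (U : R -> M) :
  is_interval A -> interior A !=set0 ->
  (forall x, A x -> has_mderive_on A U x (mderive_on A U x)) ->
  (forall x, A x -> has_mderive_on A (mderive_on A U) x (mderive_on A (mderive_on A U)
    x)) ->
  (forall x, A x -> has_mderive_on A (mderive_on A (mderive_on A U)) x
     (mderive_on A (mderive_on A (mderive_on A U)) x)) ->
  forall x, A x ->
  let D := mx_act A (fun x => (rF2 x)%:M) (rF1 N nu) (fun=> rV R N) in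
  let E := mx_act A (fun=> 0) (@rG1 R N) (fun=> rA0 N nu) in
  E (D U) x = D (E U) x.
Proof.
move=> iA intA h1 h2 h3 x Ax D E.
have pA y : A y -> ProperFilter (within A y^') by exact: within_dnbhs_proper.
set U1 := mderive_on A U in h1 h2 h3.
set U2 := mderive_on A U1 in h2 h3.
set U3 := mderive_on A U2 in h3.
have hD : mderive_on A (D U) x = U3 x *m (rF2 x)%:M + U2 x *m (- 2 * x)%:M
   + (U2 x *m rF1 N nu x + U1 x *m (- (N%:R + 2 * nu + 1)%:M)) + U1 x *m rV R N.
  apply: mderive_onE (pA _ Ax) _; apply: has_mderive_onD; last first.
    by apply: has_mderive_onMr; exact: h1.
  apply: has_mderive_onD; first exact: has_mderive_onM (h3 _ Ax) (@has_F2 A x).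
  exact: has_mderive_onM (h2 _ Ax) (@has_F1 A x).
(* Stated on all of [A], since this derivative is differentiated once more. *)
have hE y : A y -> mderive_on A (E U) y =
    U2 y *m rG1 N y + U1 y *m rB1 R N + U1 y *m rA0 N nu.
  move=> Ay; apply: mderive_onE (pA _ Ay) _.
  rewrite (_ : E U = fun z => U1 z *m rG1 N z + U z *m rA0 N nu); last first.
    by apply/funext => z; rewrite /E /mx_act mulmx0 add0r.
  apply: has_mderive_onD; last by apply: has_mderive_onMr; exact: h1.
  exact: has_mderive_onM (h2 _ Ay) (@has_G1 A y).
have hE2 : mderive_on A (mderive_on A (E U)) x =
    U3 x *m rG1 N x + U2 x *m rB1 R N + U2 x *m rB1 R N + U2 x *m rA0 N nu.
  apply: mderive_onE (pA _ Ax) _.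
  apply: (@has_mderive_on_ext _ _ _ _ _
     (fun y => U2 y *m rG1 N y + U1 y *m rB1 R N + U1 y *m rA0 N nu)) => //.
    by move=> y; rewrite inE => /hE.
  apply: has_mderive_onD; last by apply: has_mderive_onMr; exact: h2.
  apply: has_mderive_onD; last by apply: has_mderive_onMr; exact: h2.
  exact: has_mderive_onM (h3 _ Ax) (@has_G1 A x).
have -> : E (D U) x = mderive_on A (D U) x *m rG1 N x + D U x *m rA0 N nu.
  by rewrite /E /mx_act mulmx0 add0r.
have -> : D (E U) x = mderive_on A (mderive_on A (E U)) x *m (rF2 x)%:M
  + mderive_on A (E U) x *m rF1 N nu x + E U x *m rV R N by [].
have -> : E U x = U1 x *m rG1 N x + U x *m rA0 N nu by rewrite /E /mx_act mulmx0 add0r.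
have -> : D U x = U2 x *m (rF2 x)%:M + U1 x *m rF1 N nu x + U x *m rV R N by [].
rewrite hD hE2 (hE _ Ax).
(* Multiplied on the left by U'', U' and U, the three identities make the claim linear in the
   remaining matrix products, which are then treated as atoms. *)
move: (comm_F1_G1 x) (comm_F0 x) comm_VA0.
move: (U x) (U1 x) (U2 x) (U3 x) (rF1 N nu x) (rG1 N x) (rB1 R N) (rA0 N nu) (rV R N).
move: (rF2 x) (N%:R + 2 * nu + 1) => f c u u1 u2 u3 F1 G1 B1 A0 V.
move=> /(canRL (subrK _))/(congr1 (mulmx u2)) e2 /(congr1 (mulmx u1))
  e1 /(congr1 (mulmx u)) e0.
move: e0 e1 e2; rewrite !(mulmxDl, mulmxDr, mulmxN, mulNmx, mulmxA).
rewrite -?scalemxAr !mul_mx_scalar -?scalemxAl !scalerA .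
move: (u *m V *m A0) (u *m A0 *m V) (u1 *m V *m G1) (u1 *m F1 *m A0) (u1 *m B1 *m F1).
move: (u1 *m A0 *m F1) (u1 *m G1 *m V) (u1 *m G1) (u2 *m F1 *m G1) (u2 *m G1 *m F1).
move: (u2 *m G1) (u2 *m B1) (u2 *m A0) (u3 *m G1) =>
  a1 a2 a3 a4 a5 a6 a7 a8 a9 a10 a11 a12 a13 a14.
move=> -> e1 ->; apply/matrixP => i j; move/matrixP/(_ i j): e1; rewrite !mxE; lra.
Qed.
End commute.

(** * Integrals against the Gegenbauer weight *)

Section arcsine_integrable.
Variable R : realType.
Implicit Types x : R.
Local Notation mu := (@lebesgue_measure R).
Local Notation arcsine := (fun x : R => (Num.sqrt (1 - x ^+ 2))^-1).

Let sq_lt1 x : -1 < x < 1 -> 0 < 1 - x ^+ 2.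
Proof. by move=> /andP[h1 h2]; nra. Qed.

Lemma continuous_arcsine x : -1 < x < 1 -> {for x, continuous arcsine}.
Proof.
move=> /sq_lt1 x0; apply: cvgV; first by rewrite gt_eqF// sqrtr_gt0.
apply: (@continuous_comp _ _ _ (fun x => 1 - x ^+ 2) Num.sqrt);
  last exact: sqrt_continuous.
apply: cvgB; first exact: cvg_cst.
exact: exprn_continuous.
Qed.

(** On [-b, b] with b < 1 the integral is asin b - asin (-b) <= pi; monotone convergence extends the
    bound to the open interval. *)
Lemma integrable_arcsine : mu.-integrable `]-1, 1[ (EFin \o arcsine).
Proof.
(* The shift by 2 gives b 0 = 1/2, so every interval [-b n, b n] is nondegenerate. *)
pose b (n : nat) : R := 1 - n.+2%:R^-1.
have b1 n : b n < 1 by rewrite /b ltrBlDr ltrDl invr_gt0.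
have b0 n : 0 < b n.
  by rewrite /b subr_gt0 invf_lt1// ltr1n.
pose F n : set R := `[- b n, b n]%classic.
have F1 n x : F n x -> -1 < x < 1.
  rewrite /F/= in_itv/= => /andP[h1 h2].
  by have bn := b1 n; apply/andP; split; lra.
have UF : \bigcup_n F n = `]-1, 1[%classic.
  apply/seteqP; split=> [x [n _ /F1]|x]; first by rewrite /= in_itv.
  rewrite /= in_itv/= => /andP[x1 x2].
  have x0 : 0 < 1 - `|x| by rewrite subr_gt0 ltr_norml x1.
  have [n _ /(_ n (leqnn n)) nx] := near_infty_natSinv_lt (PosNum x0).
  exists n => //; rewrite /F/= in_itv/= -ler_norml /b.
  have : n.+2%:R^-1 <= n.+1%:R^-1 :> R by rewrite lef_pV2 ?posrE// ler_nat.
  by move: nx => /=; move: (n.+1%:R^-1) (n.+2%:R^-1) => u v; lra.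
have mf : measurable_fun (`]-1, 1[%classic : set R) arcsine.
  apply: subspace_continuous_measurable_fun => //.
  apply: continuous_in_subspaceT => x; rewrite inE/= in_itv/=.
  exact: continuous_arcsine.
have mFn n : measurable_fun (F n) (EFin \o arcsine).
  apply/measurable_EFinP; apply: measurable_funS mf => //.
  by move=> x /F1; rewrite /= in_itv.
have intF n : (\int[mu]_(x in F n) (EFin \o arcsine) x <= pi%:E)%E.
  rewrite /F (@continuous_FTC2 _ _ asin).
  - rewrite -EFinB lee_fin lerBlDr.
    have bn1 : -1 <= b n <= 1 by have := b0 n; have := b1 n; lra.
    have bn2 : -1 <= - b n <= 1 by lra.
    by have := asin_lepi2 bn1; have := asin_geNpi2 bn2; lra.
  - by have := b0 n; lra.
  - apply: continuous_in_subspaceT => x; rewrite inE => /F1.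
    exact: continuous_arcsine.
  - split=> [x||].
    + rewrite in_itv/= => /andP[h1 h2].
      have [] // := @is_derive1_asin R x.
      by have bn := b1 n; apply/andP; split; lra.
    + apply: cvg_at_right_filter; apply: continuous_asin.
      by have := b0 n; have := b1 n; lra.
    + apply: cvg_at_left_filter; apply: continuous_asin.
      by have := b0 n; have := b1 n; lra.
  - move=> x; rewrite in_itv/= => /andP[h1 h2]; rewrite derive1E.
    have x1 : -1 < x < 1 by have bn := b1 n; apply/andP; split; lra.
    by have [_ ->] := is_derive1_asin x1.
apply/integrableP; split; first exact/measurable_EFinP.
under eq_integral => x _.
  rewrite gee0_abs; last by rewrite lee_fin invr_ge0.
  over.
rewrite -UF; apply: (@le_lt_trans _ _ pi%:E); last by rewrite ltry.
have cv : (\int[mu]_(x in F i) (EFin \o arcsine) x)%E @[i --> \oo] -->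
    (\int[mu]_(x in \bigcup_i F i) (EFin \o arcsine) x)%E.
  apply: ge0_nondecreasing_set_cvg_integral => //.
  - apply/nondecreasing_seqP => n; rewrite subsetEset /F => x /=.
    rewrite !in_itv/= => /andP[h1 h2].
    have : b n <= b n.+1 by rewrite /b lerB// lef_pV2 ?posrE// ler_nat.
    by move=> ?; apply/andP; split; lra.
  - by move=> n; exact: measurable_itv.
  - by move=> n x _; rewrite lee_fin invr_ge0.
rewrite -(cvg_lim _ cv)//; apply: lime_le; first by apply/cvg_ex; eexists; exact: cv.
exact: nearW.
Qed.
End arcsine_integrable.

Section weight_integrable.
Variable R : realType.
Implicit Types x nu : R.
Local Notation mu := (@lebesgue_measure R).

Let sq_lt1 x : -1 < x < 1 -> 0 < 1 - x ^+ 2.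
Proof. by move=> /andP[h1 h2]; nra. Qed.

Definition wfun nu x : R := (1 - x ^+ 2) `^ (nu - 2^-1).

(* The right-hand side is the derivative of arcsine, hence integrable. *)
Lemma wfun_le nu x : 0 < nu -> -1 < x < 1 ->
  `|wfun nu x| <= (Num.sqrt (1 - x ^+ 2))^-1.
Proof.
move=> nu0 /sq_lt1 a0; rewrite ger0_norm ?powR_ge0// /wfun.
have a1 : 1 - x ^+ 2 <= 1 by rewrite lerBlDr lerDl sqr_ge0.
apply: (@le_trans _ _ ((1 - x ^+ 2) `^ (- 2^-1))).
  by rewrite ger_powR ?a0// lerDr ltW.
by rewrite powRN powR12_sqrt// ltW.
Qed.

(** A continuous [c] is bounded on [-1, 1], so the product is dominated by a multiple of the arcsine
    derivative. *)
Lemma integrable_wfun nu (c : R -> R) : 0 < nu -> {within `[-1, 1], continuous c} ->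
  mu.-integrable `]-1, 1[ (EFin \o (fun x => c x * wfun nu x)).
Proof.
move=> nu0 cc.
have [M [M0 cM]] : exists M, 0 < M /\ forall x, -1 <= x <= 1 -> `|c x| <= M.
  have /compact_bounded[M [_ Mc]] := continuous_compact cc (@segment_compact _ (-1) 1).
  exists (`|M| + 1); split; first by rewrite ltr_wpDl.
  move=> x x1; apply: (Mc (`|M| + 1)); first by rewrite (le_lt_trans (ler_norm M))//
    ltrDl.
  by exists x => //; rewrite /= in_itv.
apply: (le_integrable _ _ _ (integrableZl _ M (integrable_arcsine R))) => //.
  apply/measurable_EFinP; apply: measurable_funM.
    apply: (@measurable_funS _ _ _ _ (`[-1, 1]%classic : set R)) => //.
      by move=> x /=; rewrite !in_itv/= => /andP[h1 h2]; rewrite !ltW.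
    exact: subspace_continuous_measurable_fun.
  apply: measurable_funTS; apply: (measurableT_comp (measurable_powR _)).
  by apply: measurable_funB => //; exact: measurable_funX.
move=> x /=; rewrite in_itv/= => x1; rewrite lee_fin !normrM.
rewrite (gtr0_norm M0) [`|(_)^-1|]ger0_norm ?invr_ge0//.
apply: ler_pM => //; last exact: wfun_le.
by apply: cM; case/andP: x1 => h1 h2; rewrite !ltW.
Qed.

(* g may be unbounded at the endpoints: instead of a limit of integrals over [a, b], compare
   G with the indefinite integral of g, which is continuous on [-1, 1]. *)
Lemma integral_derive_eq0 (G g : R -> R) :
  {within `[-1, 1], continuous G} -> G (-1) = 0 -> G 1 = 0 ->
  (forall x, -1 < x < 1 -> is_derive x 1 G (g x)) ->
  (forall x, -1 < x < 1 -> {for x, continuous g}) ->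
  mu.-integrable `]-1, 1[ (EFin \o g) ->
  \int[mu]_(x in `]-1, 1[) g x = 0.
Proof.
move=> cG Gm1 G1 dG wcoef ig.
have ig' : mu.-integrable `[-1, 1] (EFin \o g).
  have /integrableP[mg foo] := ig; apply/integrableP; split.
    exact/emeasurable_fun_itv_obnd_cbndP/emeasurable_fun_itv_bndo_bndcP.
  rewrite integral_itv_bndoo//; exact: measurableT_comp.
pose Phi x := parameterized_integral mu (-1) x g.
have cPhi : {within `[-1, 1], continuous Phi}.
  by apply: parameterized_integral_continuous => //; lra.
have dPhi x : -1 < x < 1 -> is_derive x 1 Phi (g x).
  move=> x1; have /andP[xm1 x11] := x1.
  have [d1 d2] := continuous_FTC1_closed x11 ig' xm1 (wcoef _ x1).
  by apply: DeriveDef; [exact: d1|rewrite -derive1E; exact: d2].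
have [|||] := @MVT_segment R (Phi \- G) (fun=> 0) (-1) 1.
- lra.
- move=> x; rewrite in_itv/= => x1.
  rewrite -(subrr (g x)); apply: is_deriveB; [exact: dPhi|exact: dG].
- by move=> x; apply: continuousB; [exact: cPhi|exact: cG].
move=> c _; rewrite mul0r /= Gm1 G1 !subr0.
rewrite /Phi /parameterized_integral set_itv1 Rintegral_set1 subr0 => <-.
rewrite Rintegral_itv_obnd_cbnd//; apply: Rintegral_itv_bndo_bndc.
apply: integrableS ig' => // x /=; rewrite !in_itv/= => /andP[-> ?].
by rewrite ltW.
Qed.
End weight_integrable.

(** * Differentiation and continuity of powers of 1 - x^2 *)

Section weight_calculus.
Variable R : realType.
Implicit Types (x nu d : R) (A : set R) (f : R -> R).

Lemma has_derive_on_is_derive A f x d :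
  nbhs x A -> has_derive_on A f x d -> is_derive x 1 f d.
Proof.
move=> xA hd.
suff h : h^-1 *: (f (h *: 1 + x) - f x) @[h --> 0^'] --> d.
  by apply: DeriveDef; [apply/cvg_ex; exists d|exact: cvg_lim].
have -> : (fun h : R => h^-1 *: (f (h *: (1 : R) + x) - f x))
  = diffquot f x \o (fun h => h + x).
  apply/funext => h /=; rewrite /diffquot addrK [h *: _]mulr1 mulrC.
  by rewrite /GRing.scale/= mulrC.
apply: cvg_comp hd => P; rewrite /within/= => xP.
have /nbhs_ballP[e /= e0 eP] : \forall y \near x, y != x -> P (diffquot f x y).
  by apply: filterS2 xA xP => y Ay h yx; exact: h.
apply/nbhs_ballP; exists e => //= h he h0; apply: eP.
  by move: he; rewrite /ball/= sub0r normrN opprD addrCA subrr addr0 normrN.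
by rewrite -subr_eq0 addrK.
Qed.

Lemma is_derive_has_derive_on A f x d : is_derive x 1 f d -> has_derive_on A f x d.
Proof.
move=> [/cvg_ex[l hl] dE].
have {l} {}hl : h^-1 *: (f (h *: 1 + x) - f x) @[h --> 0^'] --> d.
  by rewrite -dE /derive (cvg_lim _ hl).
change (diffquot f x @ within A x^' --> d).
have -> : diffquot f x = (fun h : R => h^-1 *: (f (h *: (1 : R) + x) - f x))
  \o (fun y => y - x).
  apply/funext => y /=; rewrite /diffquot [(y - x) *: _]mulr1 subrK.
  by rewrite /GRing.scale/= mulrC.
apply: cvg_comp hl => P /nbhs_ballP[e /= e0 eP]; rewrite /within/=.
apply/nbhs_ballP; exists e => //= y ye yx _; apply: eP.
  by move: ye; rewrite /ball/= sub0r opprB.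
by rewrite subr_eq0.
Qed.

Lemma has_derive_on_horner A x (p : {poly R}) :
  has_derive_on A (horner p) x (deriv p).[x].
Proof.
elim/poly_ind: p => [|p c IH].
  rewrite deriv0 horner0 (_ : horner 0 = fun=> 0); first exact: has_derive_on_cst.
  by apply/funext => y; rewrite horner0.
rewrite (_ : horner _ = fun y => p.[y] * y + c); last first.
  by apply/funext => y; rewrite !hornerE.
have := has_derive_onD (has_derive_onM IH (has_derive_on_id A x))
  (has_derive_on_cst A x c).
by rewrite derivMXaddC !hornerE addrC.
Qed.

(** The product (1 - x^2) w. For every nu > 0 it is continuous on [-1, 1] and zero at both
    endpoints, even where w is unbounded. *)
Definition efun nu x : R := (1 - x ^+ 2) `^ (nu + 2^-1).

Lemma efunE nu x : -1 < x < 1 -> efun nu x = (1 - x ^+ 2) * wfun nu x.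
Proof.
move=> /andP[h1 h2]; have a0 : 0 < 1 - x ^+ 2 by nra.
rewrite /efun /wfun -[X in X * _](powRr1 (ltW a0)) -powRD; last by rewrite (gt_eqF a0)
  implybT.
by congr (_ `^ _); field.
Qed.

Let one_sub_sq A x : has_derive_on A (fun y => 1 - y ^+ 2) x (- 2 * x).
Proof.
have := @has_derive_on_horner A x (1 - 'X ^+ 2).
rewrite (_ : horner _ = fun y => 1 - y ^+ 2); last first.
  by apply/funext => y; rewrite !hornerE.
by rewrite derivB -polyC1 derivC derivXn sub0r hornerN hornerMn hornerX mulNr mulr_natl.
Qed.

Lemma has_derive_on_efun A nu x : -1 < x < 1 ->
  has_derive_on A (efun nu) x (- ((2 * nu + 1) * x) * wfun nu x).
Proof.
move=> /andP[h1 h2]; have a0 : 0 < 1 - x ^+ 2 by nra.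
apply: is_derive_has_derive_on.
have h : is_derive x 1 (fun y => 1 - y ^+ 2) (- 2 * x).
  by apply: (@has_derive_on_is_derive setT); [exact: filterT|exact: one_sub_sq].
have h' := is_derive1_powR (nu + 2^-1) a0.
have := @is_derive1_comp R (fun y : R => y `^ (nu + 2^-1)) (fun y : R => 1 - y ^+ 2)
  x _ _ h' h.
rewrite (_ : _ * (- 2 * x) = - ((2 * nu + 1) * x) * wfun nu x)//.
rewrite /wfun (_ : nu + 2^-1 - 1 = nu - 2^-1); last by field.
by field.
Qed.

Lemma efun_root nu x : 0 < nu -> x ^+ 2 = 1 -> efun nu x = 0.
Proof.
move=> nu0 x1; by rewrite /efun x1 subrr powR0// gt_eqF// addr_gt0// invr_gt0.
Qed.

Lemma continuous_wfun nu x : -1 < x < 1 -> {for x, continuous (wfun nu)}.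
Proof.
move=> /andP[h1 h2]; have a0 : 0 < 1 - x ^+ 2 by nra.
apply: (@continuous_comp _ _ _ (fun y : R => 1 - y ^+ 2) (fun y : R =>
  y `^ (nu - 2^-1))).
  by apply: cvgB; [exact: cvg_cst|exact: exprn_continuous].
apply: differentiable_continuous; apply/derivable1_diffP.
by apply: derivable_powR; rewrite in_itv/= a0.
Qed.

Lemma powR_cvg_ge0 (p : R) : 0 < p -> {within `[0, +oo[, continuous (fun y : R =>
  y `^ p)}.
Proof.
move=> p0; apply/continuous_within_itvcyP; split.
  move=> x; rewrite in_itv/= andbT => x0.
  apply: differentiable_continuous; apply/derivable1_diffP.
  by apply: derivable_powR; rewrite in_itv/= x0.
by rewrite powR0 ?gt_eqF//; exact: powR_cvg0.
Qed.

Lemma continuous_efun nu : 0 < nu -> {within `[-1, 1], continuous (efun nu)}.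
Proof.
move=> nu0; have p0 : 0 < nu + 2^-1 by rewrite addr_gt0// invr_gt0.
have /subspace_continuousP cp := powR_cvg_ge0 p0.
apply/subspace_continuousP => /= x; rewrite in_itv/= => x1.
have ge0 (y : R) : -1 <= y <= 1 -> 0 <= 1 - y ^+ 2 by move=> /andP[? ?]; nra.
have hx : `[0, +oo[%classic (1 - (x : R) ^+ 2) by rewrite /= in_itv/= ge0.
apply: cvg_comp (cp _ hx) => P; rewrite /within/= => hP.
have c2 : {for x, continuous (fun y : R => 1 - y ^+ 2)}.
  by apply: cvgB; [exact: cvg_cst|exact: exprn_continuous].
suff : nbhs (x : R) (fun y : R => `[-1, 1]%classic y -> P (1 - y ^+ 2)) by [].
have : nbhs (x : R) (fun y : R => `[0, +oo[%classic (1 - y ^+ 2) -> P (1 - y ^+ 2)).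
  exact: c2 _ hP.
apply: filterS => y hy; rewrite /= in_itv/= => y1.
by apply: hy; rewrite /= in_itv/= ge0.
Qed.

End weight_calculus.

(** * Continuity of matrix functions on a set *)

Section cont.
Variables (R : realType) (A : set R).
Implicit Types (f g : R -> R).

Definition mx_cont p q (U : R -> 'M[R]_(p, q)) : Prop :=
  forall i j, {within A, continuous (fun x => U x i j)}.

Lemma within_contD f g : {within A, continuous f} -> {within A, continuous g} ->
  {within A, continuous (fun x => f x + g x)}.
Proof. by move=> cf wcoef x; apply: cvgD; [exact: cf|exact: wcoef]. Qed.

Lemma within_contM f g : {within A, continuous f} -> {within A, continuous g} ->
  {within A, continuous (fun x => f x * g x)}.
Proof. by move=> cf wcoef x; apply: cvgM; [exact: cf|exact: wcoef]. Qed.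

Lemma within_cont_cst (c : R) : {within A, continuous (fun _ : R => c)}.
Proof. by move=> x; exact: cvg_cst. Qed.

Lemma within_cont_sum (I : Type) (r : seq I) (f : I -> R -> R) :
  (forall i, {within A, continuous (f i)}) ->
  {within A, continuous (fun x => \sum_(i <- r) f i x)}.
Proof.
move=> h; elim: r => [|i r IH].
  rewrite (_ : (fun _ => _) = fun=> 0); first exact: within_cont_cst.
  by apply/funext => y; rewrite big_nil.
rewrite (_ : (fun _ => _) = fun y => f i y + \sum_(j <- r) f j y).
  exact: within_contD.
by apply/funext => y; rewrite big_cons.
Qed.

Lemma within_cont_horner (p : {poly R}) : {within A, continuous (horner p)}.
Proof.
by apply: continuous_subspaceT => x; exact: continuous_horner.
Qed.

Lemma mx_contD p q (U V : R -> 'M[R]_(p, q)) :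
  mx_cont U -> mx_cont V -> mx_cont (fun x => U x + V x).
Proof.
move=> hU hV i j; rewrite (_ : (fun y => _) = fun y => U y i j + V y i j).
  exact: within_contD.
by apply/funext => y; rewrite mxE.
Qed.

Lemma mx_contN p q (U : R -> 'M[R]_(p, q)) : mx_cont U -> mx_cont (fun x => - U x).
Proof.
move=> hU i j; rewrite (_ : (fun y => _) = fun y => -1 * U y i j).
  by apply: within_contM => //; exact: within_cont_cst.
by apply/funext => y; rewrite mxE mulN1r.
Qed.

Lemma mx_contM p q r (U : R -> 'M[R]_(p, q)) (V : R -> 'M[R]_(q, r)) :
  mx_cont U -> mx_cont V -> mx_cont (fun x => U x *m V x).
Proof.
move=> hU hV i j; rewrite (_ : (fun y => _) = fun y => \sum_k U y i k * V y k j).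
  by apply: within_cont_sum => k; exact: within_contM.
by apply/funext => y; rewrite mxE.
Qed.

Lemma mx_cont_cst p q (D : 'M[R]_(p, q)) : mx_cont (fun=> D).
Proof. by move=> i j; exact: within_cont_cst. Qed.

Lemma mx_cont_scalar n f : {within A, continuous f} ->
  mx_cont (fun x => (f x)%:M : 'M[R]_n).
Proof.
move=> hf i j; rewrite (_ : (fun y => _) = fun y => f y * (i == j)%:R).
  by apply: within_contM => //; exact: within_cont_cst.
by apply/funext => y; rewrite mxE mulr_natr.
Qed.

Lemma mx_cont_tr p q (U : R -> 'M[R]_(p, q)) : mx_cont U -> mx_cont (fun x => (U x)^T).
Proof.
move=> hU i j; rewrite (_ : (fun y => _) = fun y => U y j i); first exact: hU.
by apply/funext => y; rewrite mxE.
Qed.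

Lemma mx_cont_poly p q (P : 'I_p -> 'I_q -> {poly R}) :
  mx_cont (fun x => \matrix_(i, j) (P i j).[x]).
Proof.
move=> i j; rewrite (_ : (fun y => _) = horner (P i j)).
  exact: within_cont_horner.
by apply/funext => y; rewrite mxE.
Qed.

Lemma has_derive_onN f x d : has_derive_on A f x d ->
  has_derive_on A (fun y => - f y) x (- d).
Proof.
move=> hf; have := has_derive_onM (has_derive_on_cst A x (-1)) hf.
rewrite mul0r add0r mulN1r (_ : (fun y => _) = fun y => - f y)//.
by apply/funext => y; rewrite mulN1r.
Qed.

Lemma has_mderive_onN p q (U : R -> 'M[R]_(p, q)) x DU :
  has_mderive_on A U x DU -> has_mderive_on A (fun y => - U y) x (- DU).
Proof.
move=> hU i j; rewrite mxE (_ : (fun y => _) = fun y => - U y i j).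
  exact: has_derive_onN.
by apply/funext => y; rewrite mxE.
Qed.
End cont.

(* v, v1, v2, g' and h' stand for transposes, so that no symmetry of w is needed. *)
Lemma green_identity (K : numFieldType) n (u u1 u2 v v1 v2 w g g' h h' : 'M[K]_n)
  (f : K) :
  (u2 *m (f *: w) + u1 *m (2^-1 *: (g *m w + w *m g'))) *m v + u1 *m (f *: w) *m v1
  - ((u1 *m (f *: w) + u *m (2^-1 *: (g *m w + w *m g'))) *m v1 + u *m (f *: w) *m v2)
  + ((u1 *m (2^-1 *: (g *m w - w *m g')) + u *m (h *m w - w *m h')) *m v
     + u *m (2^-1 *: (g *m w - w *m g')) *m v1) =
  (u2 *m f%:M + u1 *m g + u *m h) *m w *m v
  - u *m w *m (f%:M *m v2 + g' *m v1 + h' *m v).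
Proof.
do 3![rewrite ?(mulmxDl, mulmxDr, mulmxN, mulNmx, mul_mx_scalar, mul_scalar_mx)
  -?scalemxAr -?scalemxAl ?mulmxA].
move: (u2 *m w *m v) (u1 *m w *m v1) (u *m w *m v2) (u1 *m g *m w *m v).
move: (u1 *m w *m g' *m v) (u *m g *m w *m v1) (u *m w *m g' *m v1).
move: (u *m h *m w *m v) (u *m w *m h' *m v) => a b c d e p q r s.
by apply/matrixP => i j; rewrite !mxE; field.
Qed.

(** * Green's formula *)

Section sym.
Variables (R : realType) (n : nat) (nu : R).
Hypothesis nu0 : 0 < nu.
Local Notation M := 'M[R]_n.
Local Notation I := (`[(-1 : R), 1]%classic).
Local Notation mu := (@lebesgue_measure R).
Variables (Pw Pa Pk : 'I_n -> 'I_n -> {poly R}).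
Definition wmx (x : R) : M := \matrix_(i, j) (wfun nu x * (Pw i j).[x]).
Definition emx (P : 'I_n -> 'I_n -> {poly R}) (x : R) : M :=
  \matrix_(i, j) (efun nu x * (P i j).[x]).
Local Notation W := wmx.
Local Notation Wa := (emx Pa).
Local Notation K := (emx Pk).
Variables (f2 : R -> R) (F1 : R -> M) (F0 : M).
Hypotheses (cf2 : {within I, continuous f2}) (cF1 : mx_cont I F1).
(** The symmetry equations: [Wa] = F2 W has as derivative the symmetric half of F1 W, while [K] is
    the antisymmetric half and has derivative F0 W - W F0^T. Taking both as [efun] times polynomials
    extends them continuously, by zero, to the endpoints. *)
Hypothesis (WaE : forall x, -1 < x < 1 -> Wa x = f2 x *: W x).
Hypothesis (KE : forall x, -1 < x < 1 -> K x = 2^-1 *: (F1 x *m W x - W x *m (F1 x)^T)).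
Hypothesis (dWa : forall x, -1 < x < 1 ->
  has_mderive_on I Wa x (2^-1 *: (F1 x *m W x + W x *m (F1 x)^T))).
Hypothesis (dK : forall x, -1 < x < 1 ->
  has_mderive_on I K x (F0 *m W x - W x *m F0^T)).

Definition jet_act (U U1 U2 : R -> M) x := U2 x *m (f2 x)%:M + U1 x *m F1 x + U x *m F0.

(** The scalar w leaves the matrix product, and what remains is continuous up to the endpoints. *)
Let formE (C D : R -> M) i j : mx_cont I C -> mx_cont I D ->
  exists2 c : R -> R, {within I, continuous c} &
    (fun x => (C x *m W x *m (D x)^T) i j) = fun x => c x * wfun nu x.
Proof.
move=> cC cD.
exists (fun x => (C x *m (\matrix_(i, j) (Pw i j).[x]) *m (D x)^T) i j).
  suff : mx_cont I (fun x => C x *m (\matrix_(i, j) (Pw i j).[x]) *m (D x)^T) by exact.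
  by apply: mx_contM; [apply: mx_contM => //; exact: mx_cont_poly|exact: mx_cont_tr].
have WE x : W x = wfun nu x *: \matrix_(i, j) (Pw i j).[x].
  by apply/matrixP => a b; rewrite !mxE.
by apply/funext => x; rewrite WE -scalemxAr -scalemxAl mxE mulrC.
Qed.

Lemma integrable_form (C D : R -> M) i j : mx_cont I C -> mx_cont I D ->
  mu.-integrable `]-1, 1[ (EFin \o (fun x => (C x *m W x *m (D x)^T) i j)).
Proof.
move=> cC cD; have [c cc ->] := formE i j cC cD.
exact: integrable_wfun.
Qed.

Lemma continuous_form (C D : R -> M) i j x : mx_cont I C -> mx_cont I D -> -1 < x < 1 ->
  {for x, continuous (fun x => (C x *m W x *m (D x)^T) i j)}.
Proof.
move=> cC cD x1; have [c cc ->] := formE i j cC cD.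
apply: cvgM; last exact: continuous_wfun.
by apply: (within_continuous_continuous _ cc); [lra|rewrite in_itv].
Qed.

Lemma mx_cont_emx P : mx_cont I (emx P).
Proof.
move=> i j; rewrite (_ : (fun y => _) = fun y => efun nu y * (P i j).[y]).
  by apply: within_contM; [exact: continuous_efun|exact: within_cont_horner].
by apply/funext => y; rewrite mxE.
Qed.

Lemma emx_root P x : x ^+ 2 = 1 -> emx P x = 0.
Proof. by move=> x1; apply/matrixP => i j; rewrite !mxE efun_root// mul0r. Qed.

Lemma real_sym (U U1 U2 X X1 X2 : R -> M) i j :
  mx_cont I U -> mx_cont I U1 -> mx_cont I U2 -> mx_cont I X -> mx_cont I X1 ->
    mx_cont I X2 ->
  (forall x, I x -> has_mderive_on I U x (U1 x)) ->
  (forall x, I x -> has_mderive_on I U1 x (U2 x)) ->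
  (forall x, I x -> has_mderive_on I X x (X1 x)) ->
  (forall x, I x -> has_mderive_on I X1 x (X2 x)) ->
  \int[mu]_(x in `]-1, 1[) ((jet_act U U1 U2 x *m W x *m (X x)^T) i j) =
  \int[mu]_(x in `]-1, 1[) ((U x *m W x *m (jet_act X X1 X2 x)^T) i j).
Proof.
move=> cU cU1 cU2 cX cX1 cX2 dU dU1 dX dX1.
have cjet_act V V1 V2 : mx_cont I V -> mx_cont I V1 -> mx_cont I V2 ->
  mx_cont I (jet_act V V1 V2).
  move=> h h1 h2; apply: mx_contD; last by apply: mx_contM => //; exact: mx_cont_cst.
  by apply: mx_contD; apply: mx_contM => //; exact: mx_cont_scalar.
have i1 := integrable_form i j (cjet_act _ _ _ cU cU1 cU2) cX.
have i2 := integrable_form i j cU (cjet_act _ _ _ cX cX1 cX2).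
apply/eqP; rewrite -subr_eq0 -RintegralB//; apply/eqP.
(* The bilinear concomitant: by [green_identity] its derivative is the difference of the two
   integrands, and it vanishes at both endpoints with [efun]. *)
pose Gm x := U1 x *m Wa x *m (X x)^T - U x *m Wa x *m (X1 x)^T + U x *m K x *m (X x)^T.
apply: (@integral_derive_eq0 _ (fun x => Gm x i j)).
- suff : mx_cont I Gm by exact.
  have cWa := @mx_cont_emx Pa; have cK := @mx_cont_emx Pk.
  apply: mx_contD; [apply: mx_contD; [|apply: mx_contN]|];
    by apply: mx_contM; [exact: mx_contM|exact: mx_cont_tr].
- by rewrite /Gm !emx_root ?sqrrN ?expr1n// !(mulmx0, mul0mx) subr0 addr0 mxE.
- by rewrite /Gm !emx_root ?sqrrN ?expr1n// !(mulmx0, mul0mx) subr0 addr0 mxE.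
- move=> x x1.
  have Ix : I x by rewrite /= in_itv/=; case/andP: x1 => h1 h2; rewrite !ltW.
  apply: (@has_derive_on_is_derive _ I).
    have : \forall y \near x, y \in `]-1, 1[ by apply: near_in_itvoo; rewrite in_itv.
    apply: filterS => y; rewrite /= !in_itv/= => /andP[h1 h2].
    by rewrite !ltW.
  have hUa := has_mderive_onM (has_mderive_onM (dU1 _ Ix) (dWa x1))
    (has_mderive_on_tr (dX _ Ix)).
  have hXa := has_mderive_onM (has_mderive_onM (dU _ Ix) (dWa x1))
    (has_mderive_on_tr (dX1 _ Ix)).
  have hK := has_mderive_onM (has_mderive_onM (dU _ Ix) (dK x1))
    (has_mderive_on_tr (dX _ Ix)).
  have := has_mderive_onD (has_mderive_onD hUa (has_mderive_onN hXa)) hK.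
  move=> /(_ i j).
  set DD := (X in has_derive_on _ _ _ (X i j)).
  rewrite (_ : DD i j = (jet_act U U1 U2 x *m W x *m (X x)^T)
    i j - (U x *m W x *m (jet_act X X1 X2 x)^T) i j)//.
  have jet_actT : (jet_act X X1 X2 x)^T =
      (f2 x)%:M *m (X2 x)^T + (F1 x)^T *m (X1 x)^T + F0^T *m (X x)^T.
    by rewrite /jet_act !linearD /= !trmx_mul tr_scalar_mx.
  rewrite {}/DD (WaE x1) (KE x1) jet_actT /jet_act.
  by rewrite green_identity [LHS]mxE; congr (_ + _); rewrite [LHS]mxE.
- by move=> x x1; apply: cvgB; apply: continuous_form => //; exact: cjet_act.
- by have := integrableB _ i1 i2; apply.
Qed.
End sym.

(** * Symmetry equations of the two operators *)

Section poly.
Variables (R : realType) (nu : R) (N : nat).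
Hypothesis nu0 : 0 < nu.
Local Notation O := (1 - 'X ^+ 2 : {poly R}).

(* The exact quotient h_{m,n} / (1 - x^2); see [vpolyE]. *)
Definition rpoly (m n : nat) : {poly R} := vpoly nu N m n %/ O.

Let O0 : O != 0.
Proof.
apply/eqP => /(congr1 (fun p : {poly R} => p.[0])).
by rewrite hornerD hornerN hornerXn -polyC1 hornerC horner0 expr0n /= subr0 => /eqP;
  rewrite oner_eq0.
Qed.

Section mn.
Variables m n : nat.
Hypotheses (mN : (m <= N)%N) (nN : (n <= N)%N) (mn : m != n).

(** Off the diagonal h vanishes at 1 and at -1, so both linear factors split off. *)
Lemma vpolyE : vpoly nu N m n = O * rpoly m n.
Proof.
rewrite mulrC divpK//.
have /factor_theorem[q1 E1] : root (vpoly nu N m n) 1.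
  by apply/eqP; apply: vpoly_root => //; rewrite expr1n.
have /factor_theorem[q2 E2] : root q1 (-1).
  have : (vpoly nu N m n).[-1] = 0 by apply: vpoly_root => //; rewrite sqrrN expr1n.
  rewrite E1 hornerM hornerXsubC => /eqP; rewrite mulf_eq0 => /orP[//|].
  by rewrite -opprD oppr_eq0 -(natrD R 1 1) pnatr_eq0.
apply/dvdpP; exists (- q2); rewrite E1 E2 polyCN polyC1; ring.
Qed.

(** With e = (1 - x^2)^(nu + 1/2) one has w h = e r and e' = -(2 nu + 1) x w, so this is (w h)' = -
    w a divided by w. *)
Lemma rpoly_ode : O * deriv (rpoly m n) - (2 * nu + 1)%:P * 'X * rpoly m n = - wpoly nu
  N m n.
Proof.
apply: (mulfI O0).
have := vpoly_ode nu0 mN nN mn.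
rewrite vpolyE derivM => E.
transitivity (- (O * wpoly nu N m n)); last by ring.
rewrite -E derivB -polyC1 derivC derivXn !polyCD polyCN !polyC1.
ring.
Qed.
End mn.
End poly.

Section inst.
Variables (R : realType) (nu : R) (N : nat).
Hypotheses (nu0 : 0 < nu) (N0 : (0 < N)%N).
Local Notation M := 'M[R]_N.+1.
Local Notation I := (`[(-1 : R), 1]%classic).
Let kap : R := wconst nu N.
Definition Pw (i j : 'I_N.+1) : {poly R} := (wconst nu N)%:P * wpoly nu N i j.

Lemma rweightE x : rweight nu N x = wmx nu Pw x.
Proof. by apply/matrixP => i j; rewrite [LHS]mxE [RHS]mxE [(Pw i j).[x]]hornerM
  hornerC. Qed.

Lemma wmx_tr x : (wmx nu Pw x)^T = wmx nu Pw x.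
Proof. by apply/matrixP => i j; rewrite !mxE /Pw (wpolyC nu0 N i j). Qed.

Lemma has_mderive_emx (P : 'I_N.+1 -> 'I_N.+1 -> {poly R}) x : -1 < x < 1 ->
  has_mderive_on I (emx nu P) x
    (\matrix_(i, j) (wfun nu x * ((1 - x ^+ 2) * (deriv (P i j)).[x] - (2 * nu + 1)
      * x * (P i j).[x]))).
Proof.
move=> x1 i j; rewrite mxE.
have := has_derive_onM (@has_derive_on_efun R I nu x x1)
  (@has_derive_on_horner R I x (P i j)).
rewrite efunE// (_ : _ + _ = wfun nu x * ((1 - x ^+ 2)
  * (deriv (P i j)).[x] - (2 * nu + 1) * x * (P i j).[x])); last by ring.
rewrite (_ : (fun y => _) = (fun y => emx nu P y i j))//.
by apply/funext => y; rewrite mxE.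
Qed.

Local Notation a x m n := ((wpoly nu N m n).[x]).

Let PwE (x : R) (i j : 'I_N.+1) : (Pw i j).[x] = kap * a x i j.
Proof. by rewrite [LHS]hornerM hornerC. Qed.

Let mulW (G : M) (x : R) (i j : 'I_N.+1) :
  (G *m wmx nu Pw x) i j = wfun nu x * kap * \sum_k G i k * a x k j.
Proof.
rewrite mxE mulr_sumr; apply: eq_bigr => k _.
by rewrite mxE PwE; ring.
Qed.

Let sumRL (x : R) (i j : 'I_N.+1) (u v : R) :
  \sum_k (u *: raise_mx R N + v *: lower_mx R N) i k * a x k j =
  u * (N - i)%:R * a x i.+1 j + v * i%:R * a x i.-1 j.
Proof.
transitivity (u * (\sum_k raise_mx R N i k * a x k j)
  + v * (\sum_k lower_mx R N i k * a x k j)).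
  rewrite !mulr_sumr -big_split; apply: eq_bigr => k _.
  by rewrite /= !mxE; ring.
rewrite (sum_raise_mx i (fun k => a x k j)) (sum_lower_mx i (fun k => a x k j)).
by ring.
Qed.

Let F1W x (i j : 'I_N.+1) : (rF1 N nu x *m wmx nu Pw x) i j = wfun nu x * kap *
  ((N - i)%:R * a x i.+1 j + i%:R * a x i.-1 j - x * (N%:R + 2 * nu + 1) * a x i j).
Proof.
rewrite /rF1 mulmxBl mxE mulW [X in _ + X]mxE mul_scalar_mx.
have := sumRL x i j 1 1; rewrite !scale1r => ->.
by rewrite !mxE PwE; ring.
Qed.

Let G1W x (i j : 'I_N.+1) : (rG1 N x *m wmx nu Pw x) i j = wfun nu x * kap * N%:R^-1 *
  ((N - i)%:R * a x i.+1 j - i%:R * a x i.-1 j + (2 * i%:R - N%:R) * x * a x i j).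
Proof.
rewrite /rG1 /rB0 mulmxDl mxE [X in _ + X]mulW.
have := sumRL x i j (N%:R^-1) (- N%:R^-1); rewrite scaleNr -scalerBr => ->.
rewrite -scalemxAl /rB1 -scalemxAl mul_diag_mx !mxE PwE.
by ring.
Qed.

Section rel.
Variables (i j : 'I_N.+1) (x : R).
Let iN : (i <= N)%N. Proof. by rewrite -ltnS. Qed.
Let jN : (j <= N)%N. Proof. by rewrite -ltnS. Qed.

Let relB : (1 - x ^+ 2) * (deriv (wpoly nu N i j)).[x] =
  i%:R * a x i.-1 j + j%:R * a x j.-1 i - (i%:R + j%:R) * x * a x i j.
Proof.
have := wpoly_relB nu0 iN jN; rewrite (wpolyC nu0 N i j.-1) natrD.
move: (wpoly nu N i j) (wpoly nu N i.-1 j) (wpoly nu N j.-1 i) => p q r.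
move=> /(congr1 (horner^~ x)) /=.
by rewrite !(hornerM, hornerD, hornerN, hornerXn, hornerC, hornerX) expr2 => ->; ring.
Qed.

Let relH (b c : 'I_N.+1) : (2 * b%:R - N%:R) * x * a x b c + (N - b)%:R * a x b.+1 c
   - b%:R * a x b.-1 c = (c%:R - b%:R) * (N%:R + 2 * nu) * (vpoly nu N b c).[x].
Proof.
have bN : (b <= N)%N by rewrite -ltnS.
have cN : (c <= N)%N by rewrite -ltnS.
have := wpoly_relH nu0 bN cN.
move: (wpoly nu N b c) (wpoly nu N b.+1 c) (wpoly nu N b.-1 c) (vpoly nu N b c) =>
  p q r v.
move=> /(congr1 (horner^~ x)) /=.
by rewrite !(hornerM, hornerD, hornerN, hornerC, hornerX) => <-; ring.
Qed.

Let relS : (N - j)%:R * a x j.+1 i + j%:R * a x j.-1 i - (N - i)%:R * a x i.+1 j - i%:R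
  * a x i.-1 j
  = 2 * (i%:R - j%:R) * (N%:R - i%:R - j%:R) * (vpoly nu N i j).[x].
Proof.
have := wpoly_relS nu0 iN jN; rewrite (wpolyC nu0 N i j.-1) (wpolyC nu0 N i j.+1).
move: (wpoly nu N j.+1 i) (wpoly nu N i.+1 j) (wpoly nu N i.-1 j) (wpoly nu N j.-1 i).
move: (vpoly nu N i j) => v p q r r' /(congr1 (horner^~ x)) /=.
by rewrite !(hornerM, hornerD, hornerN, hornerC, hornerX) => <-; ring.
Qed.

(** In the sum of [relH i j] and [relH j i] the h terms cancel by symmetry of h; this eliminates the
    neighbours i + 1 and j + 1 and leaves [relB]. *)
Lemma entry_Wa : (1 - x ^+ 2) * (deriv (wpoly nu N i j)).[x] - (2 * nu + 1)
  * x * a x i j =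
  2^-1 * (((N - i)%:R * a x i.+1 j + i%:R * a x i.-1 j - x * (N%:R + 2 * nu + 1)
    * a x i j)
        + ((N - j)%:R * a x j.+1 i + j%:R * a x j.-1 i - x * (N%:R + 2 * nu + 1)
          * a x j i)).
Proof.
have := relH i j; have := relH j i; have := relB.
rewrite (wpolyC nu0 N j i) (vpolyC nu0 N j i); lra.
Qed.

Lemma entry_KD : - (i%:R - j%:R) * (N%:R - i%:R - j%:R) * (vpoly nu N i j).[x] =
  2^-1 * (((N - i)%:R * a x i.+1 j + i%:R * a x i.-1 j - x * (N%:R + 2 * nu + 1)
    * a x i j)
        - ((N - j)%:R * a x j.+1 i + j%:R * a x j.-1 i - x * (N%:R + 2 * nu + 1)
          * a x j i)).
Proof. by have := relS; rewrite (wpolyC nu0 N j i); lra. Qed.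

Lemma entry_KE (i' j' : 'I_N.+1) :
  ((N - i')%:R * a x i'.+1 j' - i'%:R * a x i'.-1 j' + (2 * i'%:R - N%:R)
    * x * a x i' j') =
  (j'%:R - i'%:R) * (N%:R + 2 * nu) * (vpoly nu N i' j').[x].
Proof. by rewrite -relH; ring. Qed.
End rel.

(** The diagonal value is arbitrary: [rP] only occurs multiplied by i - j. *)
Let rP (i j : 'I_N.+1) : {poly R} := if i == j then 0 else rpoly nu N i j.

Let efun_rP (c : R) (i j : 'I_N.+1) x : -1 < x < 1 ->
  efun nu x * ((c * (i%:R - j%:R))%:P * rP i j).[x] =
  wfun nu x * (c * (i%:R - j%:R) * (vpoly nu N i j).[x]).
Proof.
move=> x1; rewrite efunE// hornerM hornerC /rP; case: eqVneq => [->|ij].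
  by rewrite subrr mulr0 !mul0r !mulr0.
rewrite vpolyE -1?ltnS// hornerM hornerD hornerN hornerXn -polyC1 hornerC; ring.
Qed.

Let horner_ode (c x : R) (r w : {poly R}) :
  (1 - 'X ^+ 2) * deriv r - (2 * nu + 1)%:P * 'X * r = - w ->
  (1 - x ^+ 2) * (deriv (c%:P * r)).[x] - (2 * nu + 1)
    * x * (c%:P * r).[x] = - (c * w.[x]).
Proof.
move=> /(congr1 (horner^~ x)) /=; rewrite derivM derivC mul0r add0r.
rewrite !(hornerM, hornerD, hornerN, hornerXn, hornerC, hornerX) => E.
transitivity (c * ((1 - x * x) * (deriv r).[x] - (2 * nu + 1) * x * r.[x])).
  by ring.
by rewrite E; ring.
Qed.

Let deriv_rP (c : R) (i j : 'I_N.+1) x :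
  let p := (c * (i%:R - j%:R))%:P * rP i j in
  (1 - x ^+ 2) * (deriv p).[x] - (2 * nu + 1) * x * p.[x] =
  - (c * (i%:R - j%:R) * a x i j).
Proof.
rewrite /= /rP; case: eqVneq => [->|ij]; last first.
  by apply: horner_ode; apply: rpoly_ode; rewrite // -ltnS.
by rewrite mulr0 deriv0 horner0 subrr !(mulr0, mul0r) subrr oppr0.
Qed.

(** [PkD] and [PkE] are the antisymmetric halves of F1 W and G1 W divided by [efun]; their constants
    are read off from [entry_KD] and [entry_KE]. *)
Definition PkD (i j : 'I_N.+1) : {poly R} :=
  (- (kap * (N%:R - i%:R - j%:R)) * (i%:R - j%:R))%:P * rP i j.
Definition PkE (i j : 'I_N.+1) : {poly R} :=
  (- (kap * N%:R^-1 * (N%:R + 2 * nu)) * (i%:R - j%:R))%:P * rP i j.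

Local Notation W := (wmx nu Pw).

Let trW (G : M) x i j : (W x *m G^T) i j = (G *m W x) j i.
Proof. by rewrite -[in LHS](wmx_tr x) -trmx_mul mxE. Qed.

Section opD_sym.
Variable x : R.
Hypothesis x1 : -1 < x < 1.

Lemma D_WaE : emx nu Pw x = rF2 x *: W x.
Proof. by apply/matrixP => i j; rewrite !mxE efunE//; rewrite /rF2; ring. Qed.

Lemma D_KE : emx nu PkD x = 2^-1 *: (rF1 N nu x *m W x - W x *m (rF1 N nu x)^T).
Proof.
apply/matrixP => i j; rewrite [LHS]mxE [RHS]mxE [X in _ = _ * X]mxE [X in _ = _ * (_ +
  X)]mxE trW !F1W.
rewrite /PkD efun_rP//.
transitivity (wfun nu x * kap * (- (i%:R - j%:R) * (N%:R - i%:R - j%:R)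
  * (vpoly nu N i j).[x])).
  by ring.
by rewrite entry_KD; ring.
Qed.

Lemma D_dWa : has_mderive_on I (emx nu Pw) x
  (2^-1 *: (rF1 N nu x *m W x + W x *m (rF1 N nu x)^T)).
Proof.
have := @has_mderive_emx Pw x x1; set D := \matrix_(_, _) _.
suff -> : D = 2^-1 *: (rF1 N nu x *m W x + W x *m (rF1 N nu x)^T) by [].
apply/matrixP => i j; rewrite [LHS]mxE [RHS]mxE [X in _ = _ * X]mxE trW !F1W PwE.
rewrite /Pw derivM derivC mul0r add0r hornerM hornerC -/kap.
transitivity (wfun nu x * kap *
  ((1 - x ^+ 2) * (deriv (wpoly nu N i j)).[x] - (2 * nu + 1) * x * a x i j));
    first by ring.
by rewrite entry_Wa; ring.
Qed.

(** The constant in [PkD] fits because (i - j) (N - i - j) = i (N - i) - j (N - j), a difference of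
    diagonal entries of [rV]. *)
Lemma D_dK : has_mderive_on I (emx nu PkD) x (rV R N *m W x - W x *m (rV R N)^T).
Proof.
have := @has_mderive_emx PkD x x1; set D := \matrix_(_, _) _.
suff -> : D = rV R N *m W x - W x *m (rV R N)^T by [].
apply/matrixP => i j; rewrite [LHS]mxE deriv_rP [RHS]mxE [X in _ = _ + X]mxE trW.
rewrite /rV !mul_diag_mx !mxE !PwE (wpolyC nu0 N j i); ring.
Qed.

Lemma E_KE : emx nu PkE x = 2^-1 *: (rG1 N x *m W x - W x *m (rG1 N x)^T).
Proof.
apply/matrixP => i j; rewrite [LHS]mxE [RHS]mxE [X in _ = _ * X]mxE [X in _ = _ * (_ +
  X)]mxE trW !G1W.
rewrite /PkE efun_rP// !entry_KE (vpolyC nu0 N j i); field.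
by rewrite pnatr_eq0 -lt0n.
Qed.

(** There is no second-order part, so G1 W must be antisymmetric: its entries are multiples of (j -
    i) h with h symmetric. *)
Lemma E_dWa : has_mderive_on I (emx nu (fun _ _ : 'I_N.+1 => 0)) x
  (2^-1 *: (rG1 N x *m W x + W x *m (rG1 N x)^T)).
Proof.
have := @has_mderive_emx (fun _ _ : 'I_N.+1 => 0) x x1; set D := \matrix_(_, _) _.
suff -> : D = 2^-1 *: (rG1 N x *m W x + W x *m (rG1 N x)^T) by [].
apply/matrixP => i j; rewrite [LHS]mxE [RHS]mxE [X in _ = _ * X]mxE trW !G1W.
rewrite deriv0 horner0 !entry_KE (vpolyC nu0 N j i); ring.
Qed.

(** The diagonal entries of [rA0] differ by (N + 2 nu) (i - j) / N, the constant in [PkE]. *)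
Lemma E_dK : has_mderive_on I (emx nu PkE) x (rA0 N nu *m W x - W x *m (rA0 N nu)^T).
Proof.
have := @has_mderive_emx PkE x x1; set D := \matrix_(_, _) _.
suff -> : D = rA0 N nu *m W x - W x *m (rA0 N nu)^T by [].
apply/matrixP => i j; rewrite [LHS]mxE deriv_rP [RHS]mxE [X in _ = _ + X]mxE trW.
rewrite /rA0 -!scalemxAl !mul_diag_mx !mxE !PwE (wpolyC nu0 N j i); ring.
Qed.
End opD_sym.
End inst.

(** * Real and imaginary parts *)

Section cplx.
Variables (R : realType) (n : nat).
Local Notation RC := (real_complex R).
Local Notation ReM := (map_mx (@complex.Re R)).
Local Notation ImM := (map_mx (@complex.Im R)).
Implicit Types (P Q : 'M[R[i]]_n) (D : 'M[R]_n).

Let Re_real (z : R[i]) (r : R) : complex.Re (z * RC r) = complex.Re z * r.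
Proof. by case: z => a b /=; rewrite mulr0 subr0. Qed.
Let Im_real (z : R[i]) (r : R) : complex.Im (z * RC r) = complex.Im z * r.
Proof. by case: z => a b /=; rewrite mulr0 add0r. Qed.

Lemma ReM_mul_real P D : ReM (P *m map_mx RC D) = ReM P *m D.
Proof.
apply/matrixP => i j; rewrite !mxE raddf_sum; apply: eq_bigr => k _ /=.
by rewrite !mxE Re_real.
Qed.
Lemma ImM_mul_real P D : ImM (P *m map_mx RC D) = ImM P *m D.
Proof.
apply/matrixP => i j; rewrite !mxE raddf_sum; apply: eq_bigr => k _ /=.
by rewrite !mxE Im_real.
Qed.

Lemma Re_mulmx_adj P Q i j :
  complex.Re ((P *m Q^t*) i j) = (ReM P *m (ReM Q)^T) i j + (ImM P *m (ImM Q)^T) i j.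
Proof.
rewrite !mxE raddf_sum -big_split; apply: eq_bigr => k _ /=; rewrite !mxE.
by case: (P i k) (Q j k) => a b [c d] /=; ring.
Qed.
Lemma Im_mulmx_adj P Q i j :
  complex.Im ((P *m Q^t*) i j) = (ImM P *m (ReM Q)^T) i j - (ReM P *m (ImM Q)^T) i j.
Proof.
rewrite !mxE raddf_sum -sumrN -big_split; apply: eq_bigr => k _ /=; rewrite !mxE.
by case: (P i k) (Q j k) => a b [c d] /=; ring.
Qed.

Definition Ref (P : R -> 'M[R[i]]_n) (x : R) : 'M[R]_n := ReM (P x).
Definition Imf (P : R -> 'M[R[i]]_n) (x : R) : 'M[R]_n := ImM (P x).

Lemma Ref_derive A (P : R -> 'M[R[i]]_n) : Ref (mx_derive_on A P)
  = mderive_on A (Ref P).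
Proof.
apply/funext => x; apply/matrixP => i j; rewrite !mxE /=; congr derive_on.
by apply/funext => y; rewrite mxE.
Qed.
Lemma Imf_derive A (P : R -> 'M[R[i]]_n) : Imf (mx_derive_on A P)
  = mderive_on A (Imf P).
Proof.
apply/funext => x; apply/matrixP => i j; rewrite !mxE /=; congr derive_on.
by apply/funext => y; rewrite mxE.
Qed.

Section jet_act.
Variables (A : set R) (D : diffop R n) (F2 F1 F0 : R -> 'M[R]_n).
Hypotheses (D2 : forall x, dcoef2 D x = map_mx RC (F2 x))
  (D1 : forall x, dcoef1 D x = map_mx RC (F1 x))
  (D0 : forall x, dcoef0 D x = map_mx RC (F0 x)).

Lemma Ref_act (P : R -> 'M[R[i]]_n) : Ref (diffop_act A P D)
  = mx_act A F2 F1 F0 (Ref P).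
Proof.
apply/funext => x; rewrite /Ref /diffop_act D2 D1 D0 !map_mxD !ReM_mul_real.
by rewrite -/(Ref _ x) !Ref_derive -/(Ref _ x) Ref_derive.
Qed.
Lemma Imf_act (P : R -> 'M[R[i]]_n) : Imf (diffop_act A P D)
  = mx_act A F2 F1 F0 (Imf P).
Proof.
apply/funext => x; rewrite /Imf /diffop_act D2 D1 D0 !map_mxD !ImM_mul_real.
by rewrite -/(Imf _ x) !Imf_derive -/(Imf _ x) Imf_derive.
Qed.
End jet_act.

Lemma ReIm_inj (P Q : 'M[R[i]]_n) : ReM P = ReM Q -> ImM P = ImM Q -> P = Q.
Proof.
move=> /matrixP hr /matrixP hi; apply/matrixP => i j.
by apply/eqP; rewrite eq_complex; move: (hr i j) (hi i j); rewrite !mxE => -> ->;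
  rewrite !eqxx.
Qed.

Definition mCk k A (U : R -> 'M[R]_n) := forall i j, Ck_on k A (fun x => U x i j).

Lemma mCkS k A U : mCk k.+1 A U ->
  [/\ mx_cont A U, forall x, A x -> has_mderive_on A U x (mderive_on A U x)
    & mCk k A (mderive_on A U)].
Proof.
move=> h; split=> [i j|x Ax i j|i j]; have [h1 [h2 h3]] := h i j => //.
  by rewrite mxE; exact: h2.
by rewrite (_ : (fun x => _) = derive_on A (fun y => U y i j))//; apply/funext => y;
  rewrite mxE.
Qed.

Lemma mCk_cont k A U : mCk k A U -> mx_cont A U.
Proof. by move=> h i j; have := h i j; case: k {h} => [|k] []. Qed.

Lemma mCk_Ref k A (P : R -> 'M[R[i]]_n) : mx_Ck_on k A P -> mCk k A (Ref P).
Proof.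
move=> h i j; have [h1 _] := h i j.
by rewrite (_ : (fun x => _) = fun x => complex.Re (P x i j))//; apply/funext => y;
  rewrite mxE.
Qed.
Lemma mCk_Imf k A (P : R -> 'M[R[i]]_n) : mx_Ck_on k A P -> mCk k A (Imf P).
Proof.
move=> h i j; have [_ h1] := h i j.
by rewrite (_ : (fun x => _) = fun x => complex.Im (P x i j))//; apply/funext => y;
  rewrite mxE.
Qed.
End cplx.

(** * From real to complex test functions *)

Section symm.
Variables (R : realType) (N : nat) (nu : R).
Hypotheses (nu0 : 0 < nu) (N0 : (0 < N)%N).
Local Notation M := 'M[R]_N.+1.
Local Notation I := (`[(-1 : R), 1]%classic).
Local Notation mu := (@lebesgue_measure R).
Local Notation W := (wmx nu (@Pw R nu N)).

Variables (D : diffop R N.+1) (f2 : R -> R) (F1 : R -> M) (F0 : M).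
Hypotheses (D2 : forall x, dcoef2 D x = map_mx (real_complex R) (f2 x)%:M)
  (D1 : forall x, dcoef1 D x = map_mx (real_complex R) (F1 x))
  (D0 : forall x, dcoef0 D x = map_mx (real_complex R) F0).
Hypotheses (cf2 : {within I, continuous f2}) (cF1 : mx_cont I F1).
Hypothesis rsym : forall (U U1 U2 X X1 X2 : R -> M) (i j : 'I_N.+1),
  mx_cont I U -> mx_cont I U1 -> mx_cont I U2 -> mx_cont I X -> mx_cont I X1 ->
    mx_cont I X2 ->
  (forall x, I x -> has_mderive_on I U x (U1 x)) ->
  (forall x, I x -> has_mderive_on I U1 x (U2 x)) ->
  (forall x, I x -> has_mderive_on I X x (X1 x)) ->
  (forall x, I x -> has_mderive_on I X1 x (X2 x)) ->
  \int[mu]_(x in `]-1, 1[) ((jet_act f2 F1 F0 U U1 U2 x *m W x *m (X x)^T) i j) =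
  \int[mu]_(x in `]-1, 1[) ((U x *m W x *m (jet_act f2 F1 F0 X X1 X2 x)^T) i j).

Let ra := mx_act I (fun x => (f2 x)%:M) F1 (fun=> F0).

Let rsymC U X (i j : 'I_N.+1) : mCk 2 I U -> mCk 2 I X ->
  \int[mu]_(x in `]-1, 1[) ((ra U x *m W x *m (X x)^T) i j) =
  \int[mu]_(x in `]-1, 1[) ((U x *m W x *m (ra X x)^T) i j).
Proof.
move=> /mCkS[cU dU] /mCkS[cU1 dU1 /mCk_cont cU2] /mCkS[cX dX] /mCkS[cX1 dX1 /mCk_cont
  cX2].
exact (rsym i j cU cU1 cU2 cX cX1 cX2 dU dU1 dX dX1).
Qed.

Let cra U : mCk 2 I U -> mx_cont I (ra U).
Proof.
move=> /mCkS[cU dU] /mCkS[cU1 dU1 /mCk_cont cU2].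
apply: mx_contD; last by apply: mx_contM => //; exact: mx_cont_cst.
by apply: mx_contD; apply: mx_contM => //; exact: mx_cont_scalar.
Qed.

Let weightW x : weight N nu x = map_mx (real_complex R) (W x).
Proof. by rewrite weightE// rweightE. Qed.

(** For P = u + iv and Q = u' + iv' the integrand splits into real bilinear forms in (u, u'), (v,
    v'), (v, u') and (u, v'). The operator acts on each part separately, so the real symmetry
    applies four times. *)
Lemma symm_of_real : diffop_symmetric (weight N nu) D.
Proof.
move=> P Q hP hQ.
have uP := mCk_Ref hP; have vP := mCk_Imf hP.
have uQ := mCk_Ref hQ; have vQ := mCk_Imf hQ.
have cc := (mCk_cont uP, mCk_cont vP, mCk_cont uQ, mCk_cont vQ, cra uP, cra vP, cra uQ,
  cra vQ).
apply/matrixP => i j; rewrite /mx_inner /mx_Rintegral [LHS]mxE [RHS]mxE.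
have RefD P' x : map_mx (@complex.Re R) (diffop_act I P' D x) = ra (Ref P') x.
  by have /(congr1 (@^~ x)) := Ref_act I D2 D1 D0 P'.
have ImfD P' x : map_mx (@complex.Im R) (diffop_act I P' D x) = ra (Imf P') x.
  by have /(congr1 (@^~ x)) := Imf_act I D2 D1 D0 P'.
have refE (P' : R -> 'M[R[i]]_N.+1) x : map_mx (@complex.Re R) (P' x) = Ref P' x by [].
have imfE (P' : R -> 'M[R[i]]_N.+1) x : map_mx (@complex.Im R) (P' x) = Imf P' x by [].
apply: (f_equal2 (@Complex R)).
  under eq_Rintegral do rewrite weightW Re_mulmx_adj ReM_mul_real ImM_mul_real RefD
    ImfD (refE Q) (imfE Q).
  under [RHS]eq_Rintegral do rewrite weightW Re_mulmx_adj ReM_mul_real ImM_mul_real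
    RefD ImfD (refE P) (imfE P).
  rewrite !RintegralD//; try by apply: integrable_form => //; apply cc.
  by rewrite (rsymC i j uP uQ) (rsymC i j vP vQ).
under eq_Rintegral do rewrite weightW Im_mulmx_adj ReM_mul_real ImM_mul_real RefD ImfD
  (refE Q) (imfE Q).
under [RHS]eq_Rintegral do rewrite weightW Im_mulmx_adj ReM_mul_real ImM_mul_real RefD
  ImfD (refE P) (imfE P).
rewrite !RintegralB//; try by apply: integrable_form => //; apply cc.
by rewrite (rsymC i j vP uQ) (rsymC i j uP vQ).
Qed.
End symm.

(** * Conclusion for the two operators *)

Section main.
Variables (R : realType) (N : nat) (nu : R).
Hypotheses (N0 : (0 < N)%N) (nu0 : 0 < nu).
Local Notation I := (`[(-1 : R), 1]%classic).

Lemma within_cont_id A : {within A, continuous (fun x : R => x)}.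
Proof. by apply: continuous_subspaceT => x; exact: cvg_id. Qed.

Lemma mx_cont_rG1 A : mx_cont A (@rG1 R N).
Proof.
move=> i j; rewrite (_ : (fun x => _) = fun x => x * rB1 R N i j + rB0 R N i j).
  apply: within_contD; last exact: within_cont_cst.
  by apply: within_contM; [exact: within_cont_id|exact: within_cont_cst].
by apply/funext => x; rewrite !mxE.
Qed.

Lemma within_cont_rF2 A : {within A, continuous (@rF2 R)}.
Proof.
rewrite (_ : rF2 (R:=R) = horner (1 - 'X ^+ 2)); first exact: within_cont_horner.
by apply/funext => x; rewrite hornerD hornerN hornerXn -polyC1 hornerC.
Qed.

Lemma mx_cont_rF1 A : mx_cont A (rF1 N nu).
Proof.
move=> i j; rewrite (_ : (fun x => _) = fun x => (raise_mx R N i j + lower_mx R N i j)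
    + x * (- (N%:R + 2 * nu + 1) *+ (i == j))).
  apply: within_contD; first exact: within_cont_cst.
  by apply: within_contM; [exact: within_cont_id|exact: within_cont_cst].
by apply/funext => x; rewrite !mxE mulNrn mulrN mulrnAr.
Qed.

Lemma opD_symmetric : diffop_symmetric (weight N nu) (opD N nu).
Proof.
apply: (@symm_of_real _ _ _ nu0 _ (@rF2 R) (rF1 N nu) (rV R N)).
- exact: opD2E.
- exact: opD1E.
- exact: opD0E.
- exact: within_cont_rF2.
- exact: mx_cont_rF1.
- move=> *; apply: (@real_sym _ _ _ nu0 (@Pw R nu N) (@Pw R nu N) (@PkD R nu N)) => //.
  + exact: within_cont_rF2.
  + exact: mx_cont_rF1.
  + exact: D_WaE.
  + exact: D_KE.
  + exact: D_dWa.
  + exact: D_dK.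
Qed.

Lemma opE2E x : dcoef2 (opE N nu) x = map_mx (real_complex R) (0 : R)%:M.
Proof. by rewrite /= raddf0 map_mx0. Qed.

Lemma opE_symmetric : diffop_symmetric (weight N nu) (opE N nu).
Proof.
apply: (@symm_of_real _ _ _ nu0 _ (fun=> 0) (@rG1 R N) (rA0 N nu)).
- exact: opE2E.
- exact: opE1E.
- exact: opE0E.
- exact: within_cont_cst.
- exact: mx_cont_rG1.
- move=> *; apply: (@real_sym _ _ _ nu0 (@Pw R nu N) (fun _ _ => 0) (@PkE R nu N)) =>
  //.
  + exact: within_cont_cst.
  + exact: mx_cont_rG1.
  + by move=> x _; apply/matrixP => i j; rewrite !mxE horner0 mulr0 mul0r.
  + exact: E_KE.
  + exact: E_dWa.
  + exact: E_dK.
Qed.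

Lemma opD_opE_commute : diffop_commute 3 (opD N nu) (opE N nu).
Proof.
move=> A iA intA P hP x Ax.
have rc U : mCk 3 A U -> mx_act A (fun=> 0) (@rG1 R N) (fun=> rA0 N nu)
    (mx_act A (fun x => (rF2 x)%:M) (rF1 N nu) (fun=> rV R N) U) x =
  mx_act A (fun x => (rF2 x)%:M) (rF1 N nu) (fun=> rV R N)
    (mx_act A (fun=> 0) (@rG1 R N) (fun=> rA0 N nu) U) x.
  move=> /mCkS[_ h1] /mCkS[_ h2] /mCkS[_ h3 _].
  exact: real_commute.
have E2 y : dcoef2 (opE N nu) y = map_mx (real_complex R) 0 by rewrite map_mx0.
have E1 y : dcoef1 (opE N nu) y = map_mx (real_complex R) (rG1 N y) by exact: opE1E.
have E0 y : dcoef0 (opE N nu) y = map_mx (real_complex R) (rA0 N nu) by exact: opE0E.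
have D2 y : dcoef2 (opD N nu) y = map_mx (real_complex R) (rF2 y)%:M by exact: opD2E.
have D1 y : dcoef1 (opD N nu) y = map_mx (real_complex R) (rF1 N nu y) by exact: opD1E.
have D0 y : dcoef0 (opD N nu) y = map_mx (real_complex R) (rV R N) by exact: opD0E.
apply: ReIm_inj.
- have := rc _ (mCk_Ref hP).
  rewrite -(Ref_act A D2 D1 D0) -(Ref_act A E2 E1 E0).
  by rewrite -(Ref_act A E2 E1 E0) -(Ref_act A D2 D1 D0).
- have := rc _ (mCk_Imf hP).
  rewrite -(Imf_act A D2 D1 D0) -(Imf_act A E2 E1 E0).
  by rewrite -(Imf_act A E2 E1 E0) -(Imf_act A D2 D1 D0).
Qed.
End main.

(* C^3 is the regularity at which both (PD)E and (PE)D make sense. *)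
Theorem theorem2p3 (R : realType) (N : nat) (nu : R)
    (hN : (0 < N)%N) (hnu : 0 < nu) :
  diffop_symmetric (weight N nu) (opD N nu) /\
  diffop_symmetric (weight N nu) (opE N nu) /\
  diffop_commute 3 (opD N nu) (opE N nu).
Proof.
split; [|split].
- exact: opD_symmetric.
- exact: opE_symmetric.
- exact: opD_opE_commute.
Qed.
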